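(* Let $G$ be a locally compact Abelian group with dual group $\widehat{G}$, and let $q\in(2,\infty)$. Then there exists a positive constant $C$ such that, for any $(f,g)\in L^{2,1}(G)\times L^{2,1}(G)$, $$\left\|V_gf\right\|_{L^{q,1}(G\times\widehat{G})}\le C\|f\|_{L^{2,1}(G)}\|g\|_{L^{2,1}(G)}.$$
   Context: $G$ is a locally compact Abelian group (written additively) with a fixed Haar measure $\mu$; $\widehat G$ is its dual group (also written additively) with Haar measure $\mu^*$ normalized so that the Plancherel formula holds; $G\times\widehat G$ carries the Radon product measure of $\mu$ and $\mu^*$. For $x\in G$, $\xi\in\widehat G$, $\langle x,\xi\rangle$ denotes the value of the character $\xi$ at $x$, so $|\langle x,\xi\rangle|=1$. Lorentz spaces: on a measure space $(X,\lambda)$ (here $X=G$ or $X=G\times\widehat G$), for measurable $f$ let $d_f(\alpha)=\lambda(\{x\in X: |f(x)|>\alpha\})$ for $\alpha\ge 0$, and $f^*(t)=\inf\{\alpha\in(0,\infty): d_f(\alpha)\le t\}$ for $t\ge0$. For $p,q\in(0,\infty]$, $L^{p,q}(X)$ is the space of measurable $f$ with finite quasi-norm $\|f\|_{L^{p,q}(X)}=\{\int_0^\infty[t^{1/p}f^*(t)]^q\frac{dt}{t}\}^{1/q}$ if $q<\infty$, and $\|f\|_{L^{p,\infty}(X)}=\sup_{t>0}t^{1/p}f^*(t)$. One has $L^{2,1}(G)\subset L^{2,2}(G)=L^2(G)$. Short-time Fourier transform of $f$ with window $g$: for $f,g\in L^2(G)$, $$V_gf(x,\xi)=\int_G f(y)\overline{g(y-x)}\,\overline{\langle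 y,\xi\rangle}\,d\mu(y),\quad (x,\xi)\in G\times\widehat G.$$ *)

(* Defs.v *)
From HB Require Import structures.
From mathcomp Require Import all_boot all_order all_algebra.
From mathcomp Require Import complex ring lra.
From mathcomp Require Import all_classical all_reals all_analysis.
Set Implicit Arguments.
Unset Strict Implicit.
Unset Printing Implicit Defensive.
Import Order.TTheory GRing.Theory Num.Theory.
Import numFieldTopology.Exports numFieldNormedType.Exports.
Local Open Scope classical_set_scope.
Local Open Scope ring_scope.

(* The alias R[i]^o carries the norm topology of the complex numbers R[i]. *)

Section dual_group.
Context (R : realType) (G : topologicalZmodType).

Record character := Character {
  char_fun :> G -> R[i]^o ;
  char_continuous : continuous char_fun ;
  charD : forall x y, char_fun (x + y) = char_fun x * char_fun y ;
  char_norm1 : forall x, `|char_fun x| = 1 }.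

Lemma character_ext (xi eta : character) : xi =1 eta -> xi = eta.
Proof.
move: xi eta => [f fc fD f1] [g gc gD g1] /= /funext fg.
move: fc fD f1; rewrite fg => fc fD f1.
by congr Character; exact: Prop_irrelevance.
Qed.

Lemma char_neq0 (xi : character) x : xi x != 0.
Proof. by rewrite -normr_gt0 char_norm1. Qed.

Lemma char0_continuous : continuous (fun _ : G => 1 : R[i]^o).
Proof. by move=> x; exact: cst_continuous. Qed.

Lemma char0D (x y : G) : 1 = 1 * 1 :> R[i]^o.
Proof. by rewrite mulr1. Qed.

Lemma char0_norm1 (x : G) : `|1 : R[i]^o| = 1.
Proof. exact: normr1. Qed.

Definition char0 := Character char0_continuous char0D char0_norm1.

Section operations.
Variables xi eta : character.

Lemma char_add_continuous : continuous (fun x => xi x * eta x : R[i]^o).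
Proof. by move=> x; apply: continuousM; exact: char_continuous. Qed.

Lemma char_addD x y : xi (x + y) * eta (x + y) = xi x * eta x * (xi y * eta y).
Proof. by rewrite !charD mulrACA. Qed.

Lemma char_add_norm1 x : `|xi x * eta x : R[i]^o| = 1.
Proof. by rewrite normrM !char_norm1 mulr1. Qed.

Definition char_add := Character char_add_continuous char_addD char_add_norm1.

Lemma char_opp_continuous : continuous (fun x => (xi x)^-1 : R[i]^o).
Proof.
by move=> x; apply: continuousV; [exact: char_neq0|exact: char_continuous].
Qed.

Lemma char_oppD x y : (xi (x + y))^-1 = (xi x)^-1 * (xi y)^-1.
Proof. by rewrite charD invfM. Qed.

Lemma char_opp_norm1 x : `|(xi x)^-1 : R[i]^o| = 1.
Proof. by rewrite normfV char_norm1 invr1. Qed.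

Definition char_opp := Character char_opp_continuous char_oppD char_opp_norm1.

End operations.

HB.instance Definition _ := gen_eqMixin character.
HB.instance Definition _ := gen_choiceMixin character.

Lemma char_addA : associative char_add.
Proof. by move=> x y z; apply: character_ext => t /=; rewrite mulrA. Qed.

Lemma char_addC : commutative char_add.
Proof. by move=> x y; apply: character_ext => t /=; rewrite mulrC. Qed.

Lemma char_add0 : left_id char0 char_add.
Proof. by move=> x; apply: character_ext => t /=; rewrite mul1r. Qed.

Lemma char_addN : left_inverse char0 char_opp char_add.
Proof.
by move=> x; apply: character_ext => t /=; rewrite mulVf// char_neq0.
Qed.

HB.instance Definition _ :=
  GRing.isZmodule.Build character char_addA char_addC char_add0 char_addN.

Definition char_compact_open (xi : character) : {compact-open, G -> R[i]^o} :=
  xi.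

HB.instance Definition _ :=
  Topological.copy character (initial_topology char_compact_open).

Lemma char_nbhs (xi : character) (K : set G) (e : R[i]) :
  compact K -> 0 < e ->
  nbhs xi [set eta : character | forall x, K x -> `|xi x - eta x| < e].
Proof.
move=> cK e0.
have cvgxi : char_compact_open @ xi --> char_compact_open xi.
  exact: (@initial_continuous _ _ char_compact_open xi).
have FF : Filter (char_compact_open @ xi) by apply: fmap_filter; exact: nbhs_filter.
have := iffLR (compact_open_fam_compactP (@char_continuous xi) FF) cvgxi.
move=> /(iffLR (fam_cvgP _ _ FF)) /(_ K cK) cvgK.
apply: (cvgK [set h | forall x, K x -> `|xi x - h x| < e]).
apply/uniform_nbhs; exists [set xy : R[i]^o * R[i]^o | ball xy.1 e xy.2].
by split => //; rewrite -entourage_ballE; exists e.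
Qed.

Lemma char_sub_continuous :
  continuous (fun p : character * character => p.1 - p.2).
Proof.
apply: (@continuous_comp_initial _ _ _ char_compact_open) => -[xi eta] /=.
set f := (X in continuous_at _ X).
have FF : Filter (f @ (xi, eta)) by apply: fmap_filter; exact: nbhs_filter.
apply/(compact_open_fam_compactP (@char_continuous (xi - eta)) FF).
apply/fam_cvgP => K cK U /uniform_nbhs[E [+ EU]].
rewrite -entourage_ballE => -[e /= e0 eE].
have e20 : 0 < e / 2 by rewrite divr_gt0.
exists ([set xi' : character | forall x, K x -> `|xi x - xi' x| < e / 2],
        [set eta' : character | forall x, K x -> `|eta x - eta' x| < e / 2]).
  by split; exact: char_nbhs.
move=> [xi' eta'] /= [xixi' etaeta']; apply: EU => x Kx; apply: eE => /=.
rewrite /ball /= /char_compact_open /=.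
have -> : xi x / eta x - xi' x / eta' x =
    (xi x - xi' x) / eta x - xi' x * (eta x - eta' x) / eta x / eta' x.
  by have := char_neq0 eta x; have := char_neq0 eta' x => ? ?; field; apply/andP.
rewrite (le_lt_trans (ler_normB _ _))// !normrM !normfV !char_norm1.
by rewrite !invr1 !mulr1 mul1r [ltRHS]splitr ltrD ?xixi' ?etaeta'.
Qed.

HB.instance Definition _ :=
  PreTopologicalNmodule_isTopologicalZmodule.Build character
    char_sub_continuous.

End dual_group.

(* measurableType requires a base point; x0 plays no role in the Borel
   sigma-algebra of T. *)
Definition pointed_at {T : Type} (x0 : T) : Type := T.

HB.instance Definition _ (T : topologicalType) (x0 : T) :=
  Topological.copy (pointed_at x0) T.
HB.instance Definition _ (T : topologicalType) (x0 : T) :=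
  isPointed.Build (pointed_at x0) x0.

Notation borel x0 := (g_sigma_algebraType (@open (pointed_at x0))).

Section radon_haar.
Local Open Scope ereal_scope.
Context (R : realType).

Definition radon (T : topologicalType) (x0 : T)
    (mu : {measure set (borel x0) -> \bar R}) :=
  [/\ forall K : set T, compact K -> mu K < +oo,
      forall A : set (borel x0), measurable A ->
        mu A = ereal_inf [set mu U | U in [set U : set T | open U /\ A `<=` U]]
    & forall U : set T, open U ->
        mu U = ereal_sup
          [set mu K | K in [set K : set T | compact K /\ K `<=` U]]].

Definition haar (G : topologicalZmodType)
    (mu : {measure set (borel (0 : G)%R) -> \bar R}) :=
  [/\ radon mu,
      mu [set: G] != 0
    & forall (x : G) (A : set (borel (0 : G)%R)), measurable A ->
        mu [set (x + a)%R | a in (A : set G)] = mu A].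

(* The product measurable structure on X * Y is too small and the measures need
   not be sigma-finite, so the Radon product is characterized, as usual, as the
   Radon measure representing the functional f |-> \int \int f on C_c(X * Y). *)
Definition radon_product (X Y : topologicalType) (x0 : X) (y0 : Y)
    (mu : {measure set (borel x0) -> \bar R})
    (nu : {measure set (borel y0) -> \bar R})
    (rho : {measure set (borel (x0, y0)) -> \bar R}) :=
  radon rho /\
  forall f : X * Y -> R, continuous f -> compact (closure [set z | f z != 0%R]) ->
    \int[rho]_z (f z)%:E = \int[mu]_x \int[nu]_y (f (x, y))%:E.

End radon_haar.

Section complex_functions.
Context (R : realType) d (T : measurableType d).
Implicit Types (mu : {measure set T -> \bar R}) (f : T -> R[i]).

Definition cmeasurable f :=
  measurable_fun [set: T] (fun x => complex.Re (f x)) /\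
  measurable_fun [set: T] (fun x => complex.Im (f x)).

Definition cintegral mu f : R[i] :=
  Complex (\int[mu]_x complex.Re (f x)) (\int[mu]_x complex.Im (f x)).

(* Normc.normc is the modulus with values in R; `|z| lives in R[i]. *)
Definition cLnorm mu (p : \bar R) f : \bar R :=
  ('N[mu]_p [EFin \o (@Normc.normc R \o f)])%E.

End complex_functions.

Section lorentz.
Local Open Scope ereal_scope.
Context (R : realType) d (T : measurableType d).
Variable mu : {measure set T -> \bar R}.
Implicit Type f : T -> R[i].

Definition distribution_function f (a : R) : \bar R :=
  mu [set x | (a < Normc.normc (f x))%R].

Definition rearrangement f (t : R) : \bar R :=
  ereal_inf [set a%:E | a in
    [set a : R | (0 < a)%R /\ distribution_function f a <= t%:E]].

(* Meant for p, q in ]0, +oo]; p^-1 is 0 when p = +oo. *)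
Definition lorentz_norm (p q : \bar R) f : \bar R :=
  let F t := (t `^ fine p^-1)%:E * rearrangement f t in
  if q is r%:E then
    (\int[lebesgue_measure]_(t in `]0%R, +oo[%classic)
       (F t `^ r * (t^-1)%:E)) `^ r^-1
  else ereal_sup [set F t | t in `]0%R, +oo[%classic].

Definition lorentz_space (p q : \bar R) : set (T -> R[i]) :=
  [set f | cmeasurable f /\ lorentz_norm p q f < +oo].

End lorentz.

Section time_frequency.
Context (R : realType) (G : topologicalZmodType).
Variable mu : {measure set (borel (0 : G)) -> \bar R}.
Implicit Types f g : G -> R[i].

Definition fourier f (xi : character R G) : R[i] :=
  cintegral mu (fun y : G => f y * ((xi y)^*)%C).

Definition plancherel (nu : {measure set (borel (0 : character R G)) -> \bar R}) :=
  forall f, @cmeasurable R _ (borel (0 : G)) f ->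
    (cLnorm mu 1%:E f < +oo)%E -> (cLnorm mu 2%:E f < +oo)%E ->
    cLnorm nu 2%:E (fourier f) = cLnorm mu 2%:E f.

Definition stft f g (z : G * character R G) : R[i] :=
  cintegral mu (fun y : G => f y * ((g (y - z.1))^*)%C * ((z.2 y)^*)%C).

End time_frequency.

(* Main.v *)
Require Import Defs.
From HB Require Import structures.
From mathcomp Require Import all_boot all_order all_algebra.
From mathcomp Require Import complex ring lra.
From mathcomp Require Import all_classical all_reals all_analysis.
From mathcomp Require Import measurable_realfun.
Import Order.TTheory GRing.Theory Num.Theory.
Import numFieldTopology.Exports numFieldNormedType.Exports.
Local Open Scope classical_set_scope.
Local Open Scope ring_scope.
Set Implicit Arguments.
Unset Strict Implicit.
Unset Printing Implicit Defensive.

(** Write V for the short-time Fourier transform of f with window g, and |f|, |g|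
    for L^2 norms.  Two estimates on V suffice.

    - V is bounded by a multiple of |f| |g| (Cauchy-Schwarz and invariance of the
      Haar measure): [stft_le].
    - rho {|V| > a} is at most a multiple of |f|^2 |g|^2 / a^2: [stft_weak].  For
      fixed x, xi |-> V (x, xi) is the Fourier transform of
      y |-> f y * conj (g (y - x)), so Plancherel turns the integral of |V|^2 into
      the double integral of |f y|^2 |g (y - x)|^2, which is |f|^2 |g|^2.

    Together they bound the rearrangement of V by S min(1, t^(-1/2)) with S a
    multiple of |f| |g|, and t^(1/q - 1) min(1, t^(-1/2)) is integrable on
    ]0, +oo[ because 0 < 1/q < 1/2: [lorentz_norm1_le].  Finally the L^2 norm is
    at most the L^{2,1} norm: [integral_sqr_le_lorentz].

    G is not assumed to be sigma-compact, so neither Tonelli's theorem for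
    sigma-finite measures nor the joint measurability of (x, y) |-> g (y - x) is
    available for general f and g.  The weak estimate is therefore proved first for
    continuous functions with compact support.  There {|V| > a} is open, its rho
    measure is the supremum of that of its compact subsets, each of which lies
    below a function in C_c (G x G^), and on such functions rho is an iterated
    integral.  The double integral of |f y|^2 |g (y - x)|^2 is estimated by
    cutting the support of |g|^2 into finitely many small Borel pieces:
    [convolution_integral_le].  The two general facts needed here are that the
    dual group is locally compact, which follows from the mere existence of a
    Haar measure on it ([haar_locally_compact]), and Urysohn's lemma
    ([urysohn_compact]).

    For general f and g, density of C_c (G) in L^2 ([Cc_dense]) and the sup bound
    give C_c functions f', g' whose transform is uniformly close to V.  Thus V is
    continuous, {|V| > a} is open, and it is contained in {|V'| > a / 2} when
    |V - V'| <= a / 2; constants are lost at this point, which is harmless. *)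

Local Notation normc := (@Normc.normc _).

(** * Continuous functions with compact support *)

Section topology.
Context (R : realType).

Definition compact_support (X : topologicalType) (u : X -> R) :=
  compact (closure [set x | u x != 0]).

Lemma compact_supportP (X : topologicalType) (u : X -> R) (K : set X) :
  hausdorff_space X -> compact K -> (forall x, ~ K x -> u x = 0) ->
  compact_support u.
Proof.
move=> hX cK uK; have clK : closed K by exact: compact_closed.
apply: (subclosed_compact _ cK); first exact: closed_closure.
rewrite (closure_id K).1//; apply: closureS => x /= /eqP ux.
by apply: contrapT => /uK.
Qed.

Lemma compact_support0 (X : topologicalType) (u : X -> R) x :
  ~ closure [set x | u x != 0] x -> u x = 0.
Proof.
move=> nx; apply/eqP/negP => /negP ux; apply: nx; exact: subset_closure.
Qed.

(** The one-point compactification is normal, so Urysohn's lemma there separates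
    the closed sets K and the complement of U; the latter contains the point at
    infinity. *)
Lemma urysohn_compact (X : topologicalType) (K U : set X) :
  hausdorff_space X -> locally_compact [set: X] ->
  compact K -> open U -> K `<=` U ->
  exists phi : X -> R, [/\ continuous phi, (forall x, 0 <= phi x <= 1),
    (forall x, K x -> phi x = 1), (forall x, ~ U x -> phi x = 0) &
    compact_support phi].
Proof.
move=> hX lX cK oU KU.
pose Y : topologicalType := one_point_compactification X.
have hY : hausdorff_space Y by exact: one_point_compactification_hausdorff.
have cY : compact [set: Y] by exact: one_point_compactification_compact.
have nY : normal_space Y by exact: compact_normal.
have cS : continuous (Some : X -> Y).
  exact: one_point_compactification_some_continuous.
have clK : @closed Y (Some @` K).
  apply: compact_closed => //.
  by apply: continuous_compact => //; exact: continuous_subspaceT.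
have clU : @closed Y (~` (Some @` U)).
  by apply: open_closedC; exact: one_point_compactification_open_some.
have KU0 : ~` (Some @` U) `&` Some @` K = set0.
  rewrite -subset0 => y [nU [x Kx xy]]; apply: nU.
  by exists x => //; exact: KU.
have sUK : uniform_separator (~` (Some @` U) : set Y) (Some @` K : set Y).
  exact: (iffLR (@normal_separatorP R Y)).
have [f [cf f01 fU fK]] := iffLR (@uniform_separatorP Y R _ _) sUK.
pose g (x : X) := f (Some x).
have cg : continuous g by move=> x; apply: (@continuous_comp X Y R Some f x); [exact: cS|exact: cf].
have g01 x : 0 <= g x <= 1.
  by have := f01 (g x) (ex_intro2 _ _ (Some x) I erefl); rewrite /= in_itv.
have gU x : ~ U x -> g x = 0.
  by move=> nUx; apply: fU; exists (Some x) => // -[z Uz [zx]]; rewrite zx in Uz.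
(* Cutting off at level 1/2 keeps the support away from the point at infinity. *)
pose phi x := Num.max 0 (2 * g x - 1).
have phi_neq0 x : phi x != 0 -> 1 / 2 <= g x.
  by rewrite /phi; case: (ltP 0 (2 * g x - 1)); rewrite ?eqxx// => *; lra.
exists phi; split.
- have -> : phi = (cst 0 \max (fun x => 2 * g x - 1)) by [].
  move=> x; apply: continuous_max; first exact: cst_continuous.
  apply: cvgB; last exact: cvg_cst.
  by apply: cvgMl_tmp; exact: cg.
- move=> x; rewrite /phi; have := g01 x; case: (ltP 0 (2 * g x - 1)) => *; lra.
- move=> x Kx; have g1 : g x = 1 by apply: fK; exists (Some x) => //; exists x.
  by rewrite /phi g1; case: (ltP 0 (2 * 1 - 1 : R)); lra.
- by move=> x /gU g0; rewrite /phi g0; case: (ltP 0 (2 * 0 - 1 : R)); lra.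
- have fN : f None = 0 by apply: fU; exists None => // -[].
  have : nbhs (None : Y) (f @^-1` [set r | r < 1 / 2]).
    by apply: (cf (None : Y)); rewrite /= fN; apply: (@lt_nbhsl R 0 (1 / 2)); lra.
  case=> C [cC clC] Cf.
  apply: (compact_supportP hX cC) => // x nCx.
  apply/eqP/negP => /negP /phi_neq0; apply/negP; rewrite -ltNge.
  by apply: (Cf (Some x)); left; exists x.
Qed.

Lemma locally_compact_pair (X Y : topologicalType) :
  locally_compact [set: X] -> locally_compact [set: Y] ->
  locally_compact [set: X * Y].
Proof.
move=> lX lY [x y] _.
have [A] := lX x I; rewrite withinET => Ax [cA clA].
have [B] := lY y I; rewrite withinET => By [cB clB].
exists (A `*` B); first by rewrite withinET; exists (A, B).
split; first exact: compact_setX.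
have -> : A `*` B = (fst @^-1` A) `&` (snd @^-1` B) by [].
apply: closedI.
  by apply: (iffLR (continuous_closedP (@fst X Y))) => // z; exact: cvg_fst.
by apply: (iffLR (continuous_closedP (@snd X Y))) => // z; exact: cvg_snd.
Qed.

Lemma hausdorff_pair (X Y : topologicalType) :
  hausdorff_space X -> hausdorff_space Y -> hausdorff_space (X * Y)%type.
Proof.
move=> hX hY [x1 y1] [x2 y2] h; congr pair.
- apply: hX => A B Ax Bx.
  have [||[x y] [/= [? _] [? _]]] := h (A `*` setT) (B `*` setT).
  + by exists (A, setT) => //; split => //; exact: filterT.
  + by exists (B, setT) => //; split => //; exact: filterT.
  + by exists x.
- apply: hY => A B Ay By.
  have [||[x y] [/= [_ ?] [_ ?]]] := h (setT `*` A) (setT `*` B).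
  + by exists (setT, A) => //; split => //; exact: filterT.
  + by exists (setT, B) => //; split => //; exact: filterT.
  + by exists y.
Qed.

End topology.

(** * Integrals of nonnegative and of complex functions *)

Section nonneg_integral.
Context d (T : measurableType d) (R : realType) (mu : {measure set T -> \bar R}).
Local Open Scope ereal_scope.

(** The iterated integrals below have inner integrals that are not known to be
    measurable in the outer variable. *)
Lemma le_ge0_integral (f g : T -> \bar R) :
  (forall x, 0 <= f x) -> (forall x, f x <= g x) ->
  \int[mu]_x f x <= \int[mu]_x g x.
Proof.
move=> f0 fg; have g0 x : 0 <= g x by exact: le_trans (f0 x) (fg x).
rewrite !ge0_integralTE//; apply: ge_ereal_sup => _ [h hf <-].
by apply: ereal_sup_ubound; exists h => // x; exact: le_trans (hf x) (fg x).
Qed.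

(** The Cauchy-Schwarz inequality, from
    |f g| <= (B / A f^2 + A / B g^2) / 2. *)
Lemma integral_mul_le (f g : T -> R) (A B : R) :
  measurable_fun setT f -> measurable_fun setT g -> (0 < A)%R -> (0 < B)%R ->
  \int[mu]_x (f x ^+ 2)%:E <= (A ^+ 2)%:E ->
  \int[mu]_x (g x ^+ 2)%:E <= (B ^+ 2)%:E ->
  \int[mu]_x `|f x * g x|%:E <= (A * B)%:E.
Proof.
move=> mf mg A0 B0 fA gB.
pose a : R := (B / A / 2)%R; pose b : R := (A / B / 2)%R.
have a0 : (0 <= a)%R by rewrite !divr_ge0// ltW.
have b0 : (0 <= b)%R by rewrite !divr_ge0// ltW.
have mf2 : measurable_fun setT (fun x => (f x ^+ 2)%:E).
  by apply/measurable_EFinP; exact: measurable_funX.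
have mg2 : measurable_fun setT (fun x => (g x ^+ 2)%:E).
  by apply/measurable_EFinP; exact: measurable_funX.
apply: (@le_trans _ _
    (\int[mu]_x (a%:E * (f x ^+ 2)%:E + b%:E * (g x ^+ 2)%:E))).
  apply: le_ge0_integral => x; rewrite lee_fin//.
  have -> : (a * f x ^+ 2 + b * g x ^+ 2 =
             (`|B * f x| ^+ 2 + `|A * g x| ^+ 2) / (2 * A * B))%R.
    by rewrite !real_normK ?num_real// /a /b; field; rewrite !gt_eqF.
  rewrite ler_pdivlMr ?mulr_gt0// !normrM (gtr0_norm A0) (gtr0_norm B0).
  by have := sqr_ge0 (B * `|f x| - A * `|g x|)%R; nra.
rewrite ge0_integralD//; last 4 first.
- by move=> x _; rewrite mule_ge0// lee_fin// sqr_ge0.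
- exact: measurable_funeM.
- by move=> x _; rewrite mule_ge0// lee_fin// sqr_ge0.
- exact: measurable_funeM.
rewrite !ge0_integralZl_EFin//; try by move=> x _; rewrite lee_fin sqr_ge0.
apply: (@le_trans _ _ (a%:E * (A ^+ 2)%:E + b%:E * (B ^+ 2)%:E)).
  by apply: leeD; apply: lee_wpmul2l.
rewrite -!EFinM -EFinD lee_fin /a /b le_eqVlt; apply/orP; left; apply/eqP.
by field; rewrite !gt_eqF.
Qed.

Lemma integral_sqrD_le (f g : T -> R) :
  measurable_fun setT f -> measurable_fun setT g ->
  \int[mu]_x ((f x + g x) ^+ 2)%:E <=
  2%:E * \int[mu]_x (f x ^+ 2)%:E + 2%:E * \int[mu]_x (g x ^+ 2)%:E.
Proof.
move=> mf mg.
have mf2 : measurable_fun setT (fun x => (f x ^+ 2)%:E).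
  by apply/measurable_EFinP; exact: measurable_funX.
have mg2 : measurable_fun setT (fun x => (g x ^+ 2)%:E).
  by apply/measurable_EFinP; exact: measurable_funX.
rewrite -!ge0_integralZl_EFin//; try by move=> x _; rewrite lee_fin sqr_ge0.
rewrite -ge0_integralD//; last 4 first.
- by move=> x _; rewrite mule_ge0// lee_fin// sqr_ge0.
- exact: measurable_funeM.
- by move=> x _; rewrite mule_ge0// lee_fin// sqr_ge0.
- exact: measurable_funeM.
apply: le_ge0_integral => x; rewrite -?EFinM -?EFinD lee_fin ?sqr_ge0//.
by have := sqr_ge0 (f x - g x)%R; lra.
Qed.

End nonneg_integral.

Section modulus.
Context (R : realType).
Implicit Types z w : R[i].

Lemma normc_sqr z : normc z ^+ 2 = complex.Re z ^+ 2 + complex.Im z ^+ 2.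
Proof. by case: z => a b /=; rewrite sqr_sqrtr// addr_ge0 ?sqr_ge0. Qed.

Lemma normc_ge0 z : 0 <= normc z.
Proof. by case: z => a b; exact: sqrtr_ge0. Qed.

Lemma normrE z : `|z| = (normc z)%:C%C.
Proof. by case: z. Qed.

Lemma normc_conj z : normc (z^*)%C = normc z.
Proof. by case: z => a b /=; rewrite sqrrN. Qed.

Lemma normc_le_ReIm z : normc z <= `|complex.Re z| + `|complex.Im z|.
Proof.
rewrite -(@ler_pXn2r _ 2) ?nnegrE ?normc_ge0 ?addr_ge0// normc_sqr.
rewrite sqrrD !real_normK ?num_real// lerD2r lerDl.
by rewrite mulrn_wge0// mulr_ge0.
Qed.

Lemma Re_le_normc z : `|complex.Re z| <= normc z.
Proof.
rewrite -(@ler_pXn2r _ 2) ?nnegrE ?normc_ge0// normc_sqr.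
by rewrite !real_normK ?num_real// lerDl sqr_ge0.
Qed.

Lemma Im_le_normc z : `|complex.Im z| <= normc z.
Proof.
rewrite -(@ler_pXn2r _ 2) ?nnegrE ?normc_ge0// normc_sqr.
by rewrite !real_normK ?num_real// lerDr sqr_ge0.
Qed.

Lemma normcM z w : normc (z * w) = normc z * normc w.
Proof. exact: Normc.normcM. Qed.

Lemma normcD z w : normc (z + w) <= normc z + normc w.
Proof. exact: le_normcD. Qed.

Lemma normcB z w : normc (z - w) = normc (w - z).
Proof. by rewrite -opprB normcN. Qed.

End modulus.

Section complex_integral.
Context d (T : measurableType d) (R : realType) (mu : {measure set T -> \bar R}).
Implicit Types f g : T -> R[i].

Lemma cmeasurableB f g : cmeasurable f -> cmeasurable g ->
  cmeasurable (fun x => f x - g x).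
Proof.
move=> [fr fi] [gr gi]; split.
  under eq_fun do rewrite raddfB/=; exact: measurable_funB.
under eq_fun do rewrite raddfB/=; exact: measurable_funB.
Qed.

Lemma cmeasurableM f g : cmeasurable f -> cmeasurable g ->
  cmeasurable (fun x => f x * g x).
Proof.
move=> [fr fi] [gr gi]; split.
- rewrite (_ : (fun _ => _) = (fun x => complex.Re (f x) * complex.Re (g x) -
      complex.Im (f x) * complex.Im (g x))).
    by apply: measurable_funB; exact: measurable_funM.
  by apply/funext => x; case: (f x) => ? ?; case: (g x).
- rewrite (_ : (fun _ => _) = (fun x => complex.Re (f x) * complex.Im (g x) +
      complex.Im (f x) * complex.Re (g x))).
    by apply: measurable_funD; exact: measurable_funM.
  by apply/funext => x; case: (f x) => ? ?; case: (g x).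
Qed.

Lemma cmeasurable_conj f : cmeasurable f -> cmeasurable (fun x => (f x)^*%C).
Proof.
move=> [fr fi]; split.
- rewrite (_ : (fun _ => _) = (fun x => complex.Re (f x)))//.
  by apply/funext => x; case: (f x).
- rewrite (_ : (fun _ => _) = (fun x => - complex.Im (f x))).
    exact: measurableT_comp.
  by apply/funext => x; case: (f x).
Qed.

Lemma cmeasurable_normc f : cmeasurable f ->
  measurable_fun setT (fun x => normc (f x)).
Proof.
move=> [fr fi].
rewrite (_ : (fun _ => _) = (fun x =>
   Num.sqrt (complex.Re (f x) ^+ 2 + complex.Im (f x) ^+ 2))); last first.
  by apply/funext => x; case: (f x).
apply: (measurableT_comp (continuous_measurable_fun (@sqrt_continuous R))).
by apply: measurable_funD; exact: measurable_funX.
Qed.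

Definition cintegrable f :=
  cmeasurable f /\ (\int[mu]_x (normc (f x))%:E < +oo)%E.

Lemma cintegrable_Re f : cintegrable f ->
  mu.-integrable setT (EFin \o (fun x => complex.Re (f x))).
Proof.
move=> [[mr mi] foo]; apply/integrableP; split; first exact/measurable_EFinP.
apply: le_lt_trans foo; apply: le_ge0_integral => //= x.
by rewrite lee_fin Re_le_normc.
Qed.

Lemma cintegrable_Im f : cintegrable f ->
  mu.-integrable setT (EFin \o (fun x => complex.Im (f x))).
Proof.
move=> [[mr mi] foo]; apply/integrableP; split; first exact/measurable_EFinP.
apply: le_lt_trans foo; apply: le_ge0_integral => //= x.
by rewrite lee_fin Im_le_normc.
Qed.

Lemma cintegralB f g : cintegrable f -> cintegrable g ->
  cintegral mu (fun x => f x - g x) = cintegral mu f - cintegral mu g.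
Proof.
move=> intf intg; rewrite /cintegral /=.
have -> (a b c e : R) : (Complex a b - Complex c e = Complex (a - c) (b - e))%R.
  by [].
rewrite -!RintegralB//; try exact: cintegrable_Re; try exact: cintegrable_Im.
by congr Complex; apply: eq_Rintegral => x _; case: (f x); case: (g x).
Qed.

(** The factor 2 is the price of bounding the two coordinates separately. *)
Lemma normc_cintegral f (M : R) : cmeasurable f ->
  (\int[mu]_x (normc (f x))%:E <= M%:E)%E -> normc (cintegral mu f) <= 2 * M.
Proof.
move=> mf fM; have intf : cintegrable f.
  by split => //; exact: le_lt_trans fM (ltry _).
have M_ge (h : T -> R) : mu.-integrable setT (EFin \o h) ->
    (forall x, `|h x| <= normc (f x)) -> `|\int[mu]_x h x| <= M.
  move=> inth hf; rewrite (le_trans (le_normr_Rintegral _ inth))//.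
  rewrite -lee_fin fineK; last first.
    by have /integrable_abse/integrable_fin_num := inth; exact.
  by apply: le_trans fM; apply: le_ge0_integral => x; rewrite lee_fin.
rewrite (le_trans (normc_le_ReIm _))// mulr_natl mulr2n lerD//=.
- by apply: M_ge; [exact: cintegrable_Re|move=> x; exact: Re_le_normc].
- by apply: M_ge; [exact: cintegrable_Im|move=> x; exact: Im_le_normc].
Qed.

End complex_integral.

(** * The Lorentz space L^{2,1} and the Lebesgue space L^2 *)

Section staircase.
Context (R : realType).
Implicit Types a b : R.

(** The approximation of a >= 0 from below by multiples of 1 / n.+1, written as a
    sum over thresholds so that composition with a function u is a combination of the
    indicators of the superlevel sets of u: such a combination is compared with the
    measures of these sets by Minkowski's inequality, and with the rearrangement
    of u by counting thresholds. *)
Definition staircase (n : nat) (a : R) : R :=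
  \sum_(k < n.+1 ^ 2) n.+1%:R^-1 * (k.+1%:R / n.+1%:R < a)%R%:R.

Lemma count_below (m : nat) (b : R) : 0 <= b ->
  let c := \sum_(k < m) (k.+1%:R < b)%R%:R in
  [/\ c <= b, m%:R < b -> c = m%:R & b <= m%:R -> b - 1 <= c].
Proof.
move=> b0; elim: m => [|m [IH1 IH2 IH3]] /=.
  by rewrite big_ord0; split => //; lra.
rewrite big_ord_recr /= -natr1; have [mb|bm] := ltrP (m%:R + 1 : R) b.
  rewrite IH2; last by lra.
  by split => /=; lra.
rewrite addr0; split=> [//|mb|_]; first lra.
by have [mb|/IH3//] := ltrP (m%:R : R) b; rewrite IH2//; lra.
Qed.

Lemma staircaseE n a : staircase n a = n.+1%:R^-1 *
  \sum_(k < n.+1 ^ 2) (k.+1%:R < a * n.+1%:R)%R%:R.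
Proof.
rewrite /staircase mulr_sumr; apply: eq_bigr => k _.
by rewrite ltr_pdivrMr.
Qed.

Lemma staircase_ge0 n a : 0 <= staircase n a.
Proof. by apply: sumr_ge0 => k _; rewrite mulr_ge0. Qed.

Lemma staircase_le n a : 0 <= a -> staircase n a <= a.
Proof.
move=> a0; rewrite staircaseE mulrC ler_pdivrMr//.
by have [] := @count_below (n.+1 ^ 2) (a * n.+1%:R) (mulr_ge0 a0 (ler0n _ _)).
Qed.

Lemma staircase_ge n a : 0 <= a <= n.+1%:R -> a - n.+1%:R^-1 <= staircase n a.
Proof.
move=> /andP[a0 an]; rewrite staircaseE.
rewrite -(@ler_pM2r _ n.+1%:R)// mulrBl mulVf// mulrAC mulVf// mul1r.
have [_ _] := @count_below (n.+1 ^ 2) (a * n.+1%:R) (mulr_ge0 a0 (ler0n _ _)).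
by apply; rewrite natrX expr2 ler_pM2r.
Qed.

Lemma cvg_staircase a : 0 <= a -> staircase n a @[n --> \oo] --> a.
Proof.
move=> a0; apply: (@squeeze_cvgr _ _ _ _ (fun n => a - n.+1%:R^-1) (cst a)).
- near=> n; rewrite staircase_le// andbT staircase_ge// a0/=.
  near: n; exists (Num.truncn a) => // n /= an.
  by rewrite (le_trans (ltW (truncnS_gt a)))// ler_nat ltnS.
- by rewrite -[X in _ --> X]subr0; apply: cvgB; [exact: cvg_cst|exact: cvg_harmonic].
- exact: cvg_cst.
Unshelve. all: by end_near. Qed.

End staircase.

Section staircase_measurable.
Context d (T : measurableType d) (R : realType) (u : T -> R).
Hypothesis mu : measurable_fun setT u.

Lemma measurable_superlevel (a : R) : measurable [set x | a < u x].
Proof.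
rewrite (_ : [set _ | _] = u @^-1` `]a, +oo[%classic).
  by have := mu measurableT (measurable_itv `]a, +oo[); rewrite setTI.
by apply/seteqP; split => x /=; rewrite in_itv/= andbT.
Qed.

Lemma staircase_indic n : (fun x => staircase n (u x)) =
  (fun x => \sum_(k < n.+1 ^ 2) n.+1%:R^-1 *
    \1_[set x | k.+1%:R / n.+1%:R < u x] x).
Proof.
apply/funext => x; apply: eq_bigr => k _; rewrite indicE.
congr (_ * _%:R); congr nat_of_bool.
by apply/idP/idP => [/mem_set|/set_mem].
Qed.

Lemma measurable_staircase n :
  measurable_fun setT (fun x => staircase n (u x)).
Proof.
rewrite staircase_indic; apply: measurable_sum => k.
by apply: measurable_funM => //; apply/measurable_indic/measurable_superlevel.
Qed.

End staircase_measurable.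

Section nonneg_integral_in.
Context d (T : measurableType d) (R : realType) (mu : {measure set T -> \bar R}).
Local Open Scope ereal_scope.

Lemma le_ge0_integral_in (D : set T) (f g : T -> \bar R) :
  (forall x, D x -> 0 <= f x) -> (forall x, D x -> f x <= g x) ->
  \int[mu]_(x in D) f x <= \int[mu]_(x in D) g x.
Proof.
move=> f0 fg; rewrite integral_mkcond [leRHS]integral_mkcond.
apply: le_ge0_integral => x; rewrite /patch; case: ifPn => // /set_mem Dx.
  exact: f0.
exact: fg.
Qed.

Lemma Lnorm_sum (I : Type) (s : seq I) (f : I -> T -> R) :
  (forall i, measurable_fun setT (f i)) ->
  'N[mu]_2%:E[EFin \o (fun x => \sum_(i <- s) f i x)%R] <=
  \sum_(i <- s) 'N[mu]_2%:E[EFin \o f i].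
Proof.
move=> mf; elim: s => [|i s IH].
  rewrite big_nil (_ : _ \o _ = cst 0) ?Lnorm0//.
  by apply/funext => x /=; rewrite big_nil.
rewrite big_cons.
have -> : EFin \o (fun x => \sum_(j <- i :: s) f j x)%R =
    EFin \o (f i \+ (fun x => \sum_(j <- s) f j x))%R.
  by apply/funext => x /=; rewrite big_cons.
apply: le_trans (minkowski_EFin _ _ _ _) _ => //.
- exact: measurable_sum.
- lra.
- exact: leeD2l.
Qed.

End nonneg_integral_in.

Section lorentz_L2.
Context (R : realType).
Local Open Scope ereal_scope.

(** The integral of t^(-1/2) over ]0, E[ is 2 sqrt E; bounding the integrand below
    by its value at the right end gives sqrt E, which is enough and needs no
    primitive. *)
Lemma sqrt_le_integral (E : \bar R) : 0 <= E ->
  E `^ 2^-1 <= \int[lebesgue_measure]_(t in `]0%R, +oo[)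
     ((t%:E < E)%E%:R * (t `^ 2^-1 * t^-1))%:E.
Proof.
move=> E0; set J := integral _ _ _.
have J0 : 0 <= J.
  apply: integral_ge0 => t /=; rewrite in_itv/= andbT => t0.
  by rewrite lee_fin !mulr_ge0// ?powR_ge0// invr_ge0 ltW.
have J_ge (M : R) : (0 < M)%R -> M%:E <= E -> (M `^ 2^-1)%:E <= J.
  move=> M0 ME.
  have -> : (M `^ 2^-1)%:E = \int[lebesgue_measure]_(t in `]0%R, M[)
      ((M `^ 2^-1)^-1)%:E.
    rewrite integral_cst//= lebesgue_measure_itv/= lte_fin M0.
    rewrite sube0 -EFinM; congr EFin.
    have h : (M `^ 2^-1 != 0)%R by rewrite gt_eqF// powR_gt0.
    apply: (mulfI h); rewrite mulrA mulfV// mul1r powR12_sqrt ?ltW//.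
    by rewrite -expr2 sqr_sqrtr// ltW.
  rewrite integral_mkcond [leRHS]integral_mkcond.
  apply: le_ge0_integral => t; rewrite /patch.
    by case: ifPn => // _; rewrite lee_fin invr_ge0 powR_ge0.
  case: ifPn => [/set_mem|_].
    rewrite /= in_itv/= => /andP[t0 tM].
    rewrite mem_set/=; last by rewrite in_itv/= t0.
    have tE : t%:E < E by rewrite (lt_le_trans _ ME).
    rewrite tE mul1r lee_fin !powR12_sqrt; [|exact: ltW..].
    have st : (0 < Num.sqrt t)%R by rewrite sqrtr_gt0.
    have sM : (0 < Num.sqrt M)%R by rewrite sqrtr_gt0.
    have -> : (Num.sqrt t / t = (Num.sqrt t)^-1)%R.
      rewrite -[X in (_ / X)%R](sqr_sqrtr (ltW t0)) expr2 invfM mulrA.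
      by rewrite mulfV ?gt_eqF// mul1r.
    rewrite lef_pV2 ?posrE// ler_sqrt//; exact: ltW.
  case: ifPn => // /set_mem /=; rewrite in_itv/= andbT => t0.
  by rewrite lee_fin !mulr_ge0// ?powR_ge0// invr_ge0 ltW.
move: J0 J_ge; rewrite {}/J; move: E0; case: E => [r| |//]; set J := integral _ _ _ => E0 J0 J_ge.
- rewrite poweR_EFin; move: E0; rewrite lee_fin le_eqVlt => /predU1P[<-|r0].
    by rewrite powR0.
  exact: J_ge.
- rewrite poweRyr// leye_eq; apply/eqP/eqyP => A A0.
  have -> : A = ((A ^+ 2) `^ 2^-1)%R.
    by rewrite powR12_sqrt ?sqr_ge0// sqrtr_sqr gtr0_norm.
  by apply: J_ge; rewrite ?exprn_gt0// leey.
Qed.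

Lemma measurable_below (E : \bar R) (a : R) :
  measurable_fun (`]0%R, +oo[%classic : set R)
    (EFin \o (fun t => (t%:E < E)%E%:R * (t `^ a * t^-1))%R).
Proof.
apply/measurable_EFinP; apply: measurable_funM.
  apply/measurable_funTS.
  rewrite (_ : (fun _ => _) = \1_[set t : R | t%:E < E]).
    apply: measurable_indic; case: E => [r| |].
    - have -> : [set t : R | t%:E < r%:E] = `]-oo, r[%classic; last by [].
      by apply/seteqP; split => t; rewrite /= in_itv/= lte_fin.
    - suff -> : [set t : R | t%:E < +oo] = setT by [].
      by rewrite -subTset => t _; exact: ltry.
    - have -> : [set t : R | t%:E < -oo] = set0; last exact: measurable0.
      by apply/seteqP; split => t.
  apply/funext => t; rewrite indicE; congr (_%:R)%R; congr nat_of_bool.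
  by apply/idP/idP => [/mem_set|/set_mem].
apply: measurable_funM.
  by apply: measurable_funTS; exact: measurable_powR.
apply: open_continuous_measurable_fun => [|t]; first exact: interval_open.
rewrite inE/= in_itv/= andbT => t0.
by apply: inv_continuous; rewrite gt_eqF.
Qed.

Context d (T : measurableType d) (mu : {measure set T -> \bar R}).

Lemma Lnorm_indic (c : R) (E : set T) : (0 <= c)%R -> measurable E ->
  'N[mu]_2%:E[EFin \o (fun x => c * \1_E x)%R] = c%:E * mu E `^ 2^-1.
Proof.
move=> c0 mE; rewrite unlock.
have -> : \int[mu]_x (`|(EFin \o (fun x => c * \1_E x)%R) x| `^ 2) =
    \int[mu]_x ((c ^+ 2)%:E * (\1_E x)%:E).
  apply: eq_integral => x _ /=; rewrite powR_mulrn// -EFinM; congr EFin.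
  rewrite real_normK ?num_real// exprMn; congr (_ * _)%R.
  by rewrite indicE; case: (_ \in _); rewrite ?expr1n// expr0n.
rewrite ge0_integralZl_EFin//; last 2 first.
- by apply/measurable_EFinP; exact: measurable_indic.
- by rewrite sqr_ge0.
rewrite integral_indic// setIT poweRM// ?lee_fin ?sqr_ge0//.
by rewrite poweR_EFin powR12_sqrt ?sqr_ge0// sqrtr_sqr ger0_norm.
Qed.

Lemma Lnorm2_integral (f : T -> R) (M : R) : (0 <= M)%R ->
  'N[mu]_2%:E[EFin \o f] <= M%:E -> \int[mu]_x (f x ^+ 2)%:E <= (M ^+ 2)%:E.
Proof.
move=> M0; rewrite unlock.
have -> : \int[mu]_x (`|(EFin \o f) x| `^ 2) = \int[mu]_x (f x ^+ 2)%:E.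
  apply: eq_integral => x _ /=; rewrite powR_mulrn//.
  by rewrite real_normK ?num_real.
set J := integral _ _ _ => JM.
have J0 : 0 <= J by apply: integral_ge0 => x _; rewrite lee_fin sqr_ge0.
have -> : J = (J `^ 2^-1) `^ 2 by rewrite -poweRrM mulVf// poweRe1.
have -> : (M ^+ 2)%:E = M%:E `^ 2 by rewrite poweR_EFin powR_mulrn.
by apply: gt0_ler_poweR => //; rewrite in_itv/= ?poweR_ge0 ?lee_fin ?M0 ?leey.
Qed.

Variable f : T -> R[i].

Lemma lorentz_norm1E (p : R) : p != 0%R -> lorentz_norm mu p%:E 1%:E f =
  \int[lebesgue_measure]_(t in `]0%R, +oo[)
    ((t `^ p^-1)%:E * rearrangement mu f t * (t^-1)%:E).
Proof.
move=> p0; have rearr_ge0 t : 0 <= rearrangement mu f t.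
  by apply: le_ereal_inf_tmp => _ [a [a0 _] <-]; rewrite lee_fin ltW.
rewrite /lorentz_norm invr1 poweRe1.
  apply: eq_integral => t _; rewrite inver /= (negbTE p0)/=.
  by rewrite poweRe1 ?mule_ge0// ?lee_fin ?powR_ge0.
apply: integral_ge0 => t; rewrite /= in_itv/= andbT => t0.
by rewrite mule_ge0 ?poweR_ge0// lee_fin invr_ge0 ltW.
Qed.

Hypothesis mf : cmeasurable f.

Let measurable_level (a : R) : measurable [set x | (a < normc (f x))%R].
Proof. exact/measurable_superlevel/cmeasurable_normc. Qed.

Let D (n k : nat) := distribution_function mu f (k.+1%:R / n.+1%:R).

(** If the distribution function of f is at most t at a, a threshold at which it
    exceeds t lies below a; hence the sum is at most the staircase value of a. *)
Lemma rearrangement_ge_staircase (n : nat) (t : R) :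
  (\sum_(k < n.+1 ^ 2) n.+1%:R^-1 * (t%:E < D n k)%E%:R)%:E <=
  rearrangement mu f t.
Proof.
apply: le_ereal_inf_tmp => _ [a [a0 Da] <-]; rewrite lee_fin.
apply: le_trans (staircase_le n (ltW a0)); apply: ler_sum => k _.
apply: ler_wpM2l => //; rewrite ler_nat; case: (ltP t%:E (D n k)) => //= tD; rewrite lt0b.
rewrite ltNge; apply/negP => ak.
have : D n k <= t%:E.
  apply: le_trans Da; apply: le_measure; rewrite ?inE//.
  by move=> x /=; exact: le_lt_trans.
by rewrite leNgt tD.
Qed.

(** Let E_k be the superlevel sets in the staircase of |f|.  Minkowski bounds its
    L^2 norm by the sum of sqrt (mu E_k) / n.+1, each sqrt (mu E_k) is at most the
    integral of t^(-1/2) over ]0, mu E_k[, and the sum of the indicators of these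
    intervals, divided by n.+1, is below the rearrangement of f.  Fatou's lemma concludes. *)
Lemma integral_sqr_le_lorentz : lorentz_norm mu 2%:E 1%:E f < +oo ->
  \int[mu]_x (normc (f x) ^+ 2)%:E <=
  ((fine (lorentz_norm mu 2%:E 1%:E f)) ^+ 2)%:E.
Proof.
set N := lorentz_norm _ _ _ _ => Noo.
have N0 : 0 <= N by exact: poweR_ge0.
have Nfin : N \is a fin_num by rewrite ge0_fin_numE.
have mn := cmeasurable_normc mf.
have step n : 'N[mu]_2%:E[EFin \o (fun x => staircase n (normc (f x)))] <= N.
  rewrite staircase_indic.
  apply: le_trans (Lnorm_sum _ _ _) _.
    by move=> k; apply: measurable_funM => //; exact: measurable_indic.
  apply: (@le_trans _ _ (\sum_(k < n.+1 ^ 2) \int[lebesgue_measure]_(t in `]0%R, +oo[)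
     (n.+1%:R^-1%:E * ((t%:E < D n k)%E%:R * (t `^ 2^-1 * t^-1))%:E))).
    apply: lee_sum => k _; rewrite Lnorm_indic// ge0_integralZl_EFin//=.
    - by apply: lee_wpmul2l => //; exact: sqrt_le_integral.
    - move=> t; rewrite in_itv/= andbT => t0.
      by rewrite lee_fin !mulr_ge0// ?powR_ge0// invr_ge0 ltW.
    - exact: measurable_below.
  rewrite -ge0_integral_sum//; last 2 first.
  - by move=> k; apply: measurable_funeM; exact: measurable_below.
  - move=> k t /=; rewrite in_itv/= andbT => t0.
    by rewrite -EFinM lee_fin !mulr_ge0// ?powR_ge0// invr_ge0 ltW.
  rewrite /N lorentz_norm1E//; apply: le_ge0_integral_in => t /=; rewrite in_itv/= andbT => t0.
    apply: sume_ge0 => k _.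
    by rewrite -EFinM lee_fin !mulr_ge0// ?powR_ge0// invr_ge0 ltW.
  under eq_bigr do rewrite -EFinM (mulrA n.+1%:R^-1%R).
  rewrite sumEFin -mulr_suml muleAC mulrC !EFinM; apply: lee_wpmul2l.
    by rewrite lee_fin mulr_ge0 ?powR_ge0// invr_ge0 ltW.
  exact: rearrangement_ge_staircase.
have ms n : measurable_fun setT (fun x => staircase n (normc (f x))).
  exact: measurable_staircase.
have stepI n : \int[mu]_x (staircase n (normc (f x)) ^+ 2)%:E <=
    (fine N ^+ 2)%:E.
  by apply: Lnorm2_integral; rewrite ?fine_ge0// fineK.
have -> : \int[mu]_x (normc (f x) ^+ 2)%:E =
    \int[mu]_x limn_einf (fun n => (staircase n (normc (f x)) ^+ 2)%:E).
  apply: eq_integral => x _; apply/esym.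
  suff /[dup] h : (staircase n (normc (f x)) ^+ 2)%:E @[n --> \oo] -->
      (normc (f x) ^+ 2)%:E.
    by rewrite is_cvg_limn_einfE; [exact: cvg_lim|apply/cvg_ex; eexists; exact: h].
  apply: cvg_EFin; first by exact: nearW.
  apply: (@continuous_cvg _ _ _ _ _ _ (fun x : R => x ^+ 2)%R).
    exact: exprn_continuous.
  by apply: cvg_staircase; exact: normc_ge0.
apply: le_trans (fatou _ _ _ _) _ => //.
- by move=> n; apply/measurable_EFinP; exact: measurable_funX.
- by move=> n x _; rewrite lee_fin sqr_ge0.
- rewrite limn_einf_lim; apply: lime_le; first exact: is_cvg_einfs.
  apply: nearW => n; apply: le_trans (stepI n).
  by apply: ereal_inf_lbound; exists n => /=.
Qed.

End lorentz_L2.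

(** * Lorentz norms of bounded functions of weak type (2,2) *)

Section power_integrals.
Context (R : realType).
Local Notation leb := (@lebesgue_measure R).

Lemma powR_continuous_gt0 (c x : R) : 0 < x -> {for x, continuous (@powR R ^~ c)}.
Proof.
move=> x0; apply: differentiable_continuous; apply/derivable1_diffP.
by apply: derivable_powR; rewrite in_itv/= x0.
Qed.

Lemma integral_powR (c a b : R) : c != 0 -> 0 < a -> a < b ->
  (\int[leb]_(t in `[a, b]) (t `^ (c - 1))%:E = ((b `^ c - a `^ c) / c)%:E)%E.
Proof.
move=> c0 a0 ab.
have pos x : a <= x -> 0 < x by exact: lt_le_trans.
rewrite (@continuous_FTC2 _ _ (fun t => t `^ c / c) a b ab).
- by rewrite -EFinB mulrBl.
- apply: continuous_in_subspaceT => x /set_mem /=; rewrite in_itv/= => /andP[ax _].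
  exact: powR_continuous_gt0 (pos _ ax).
- have cF x : a <= x -> {for x, continuous (fun t : R => t `^ c / c)}.
    move=> ax; apply: cvgMr_tmp; exact: powR_continuous_gt0 (pos _ ax).
  split.
  + move=> x; rewrite in_itv/= => /andP[/ltW ax _].
    apply: derivableM => //; apply: derivable_powR.
    by rewrite in_itv/= (pos _ ax).
  + by apply: cvg_at_right_filter; exact: cF.
  + by apply: cvg_at_left_filter; apply: cF; exact: ltW.
- move=> x; rewrite in_itv/= => /andP[/ltW ax _].
  have x0 := pos _ ax.
  rewrite derive1E deriveM//; last by apply: derivable_powR; rewrite in_itv/= x0.
  rewrite derive_cst scaler0 add0r -derive1E powR_derive1 ?in_itv/= ?x0//.
  by rewrite /GRing.scale /= mulrA mulVf// mul1r.
Qed.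

(** The integrand is at most t^(s - 1) on ]0, 1] and t^(s - 1/2 - 1) on ]1, +oo[;
    both are integrated over compact intervals, which exhaust ]0, +oo[. *)
Lemma integral_min_powR (s : R) : 0 < s -> s < 2^-1 ->
  (\int[leb]_(t in `]0%R, +oo[) (t `^ (s - 1) * Num.min 1 (t `^ (- 2^-1)))%:E <=
   (s^-1 + (2^-1 - s)^-1)%:E)%E.
Proof.
move=> s0 s2.
pose g t : R := t `^ (s - 1) * Num.min 1 (t `^ (- 2^-1)).
have g0 t : 0 <= g t by rewrite mulr_ge0 ?powR_ge0// le_min ler01 powR_ge0.
have mg (D : set R) : measurable_fun D (EFin \o g).
  apply/measurable_EFinP; apply: measurable_funTS; apply: measurable_funM.
    exact: measurable_powR.
  by apply: measurable_minr => //; exact: measurable_powR.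
(* The bounds use n.+2 so that 1 lies strictly inside F n. *)
pose F n : set R := `[n.+2%:R^-1, n.+2%:R]%classic.
have FE : `]0%R, +oo[%classic = \bigcup_n F n.
  apply/seteqP; split => [t|t [n _]]; rewrite /F /= !in_itv/=.
    rewrite andbT => t0; pose n := maxn (Num.truncn t) (Num.truncn t^-1).
    exists n => //=; rewrite in_itv/=; apply/andP; split.
      rewrite invf_ple ?posrE//; apply: ltW.
      apply: lt_le_trans (truncnS_gt _) _.
      by rewrite ler_nat ltnW// ltnS ltnS leq_maxr.
    apply: ltW; apply: lt_le_trans (truncnS_gt _) _.
    by rewrite ler_nat ltnW// ltnS ltnS leq_maxl.
  by move=> /andP[nt _]; rewrite andbT (lt_le_trans _ nt)// invr_gt0.
have ndF : nondecreasing_seq F.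
  move=> m n mn; apply/subsetPset => t; rewrite /F /= !in_itv/= => /andP[mt tm].
  apply/andP; split; last by rewrite (le_trans tm)// ler_nat !ltnS.
  by rewrite (le_trans _ mt)// lef_pV2 ?posrE// ler_nat !ltnS.
rewrite FE.
have cvgF : (\int[leb]_(t in F n) (g t)%:E)%E @[n --> \oo] -->
    (\int[leb]_(t in \bigcup_n F n) (g t)%:E)%E.
  apply: ge0_nondecreasing_set_cvg_integral; first exact: ndF.
  - by move=> n; exact: measurable_itv.
  - by move=> n; exact: mg.
  - by move=> n t _; rewrite lee_fin g0.
rewrite -(cvg_lim _ cvgF)//; apply: lime_le; first by apply/cvg_ex; eexists; exact: cvgF.
apply: nearW => n.
have n1 : (1 : R) < n.+2%:R by rewrite ltr1n.
have n1' : n.+2%:R^-1 < (1 : R) by rewrite invf_lt1.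
have -> : F n = (`[n.+2%:R^-1, 1] `|` `]1, n.+2%:R])%classic.
  apply/seteqP; split => t; rewrite /F /= !in_itv/=.
    by case: (leP t 1) => t1 /andP[-> ->]; [left|right].
  move=> [/andP[-> t1]|/andP[t1 ->]] /=; first exact: le_trans t1 (ltW n1).
  by rewrite andbT ltW// (lt_trans n1').
rewrite ge0_integral_setU//; last 3 first.
- exact: mg.
- by move=> t _; rewrite lee_fin g0.
- apply/disj_set2P; apply/seteqP; split => // t [] /=; rewrite !in_itv/=.
  by move=> /andP[_ t1] /andP[/lt_le_trans /(_ t1)]; rewrite ltxx.
have n0 : (0 : R) < n.+2%:R^-1 by rewrite invr_gt0.
have s20 : 0 < 2^-1 - s by rewrite subr_gt0.
rewrite EFinD; apply: leeD.
  apply: (@le_trans _ _ (\int[leb]_(t in `[n.+2%:R^-1%R, 1%R]) (t `^ (s - 1))%:E)%E).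
    apply: le_ge0_integral_in => t _; rewrite lee_fin//.
    by rewrite -[leRHS]mulr1 ler_wpM2l ?powR_ge0// ge_min lexx.
  by rewrite integral_powR ?gt_eqF// lee_fin powR1 ler_pdivrMr// mulVf ?gt_eqF// gerBl powR_ge0.
apply: (@le_trans _ _ (\int[leb]_(t in `[1%R, n.+2%:R%R]) (t `^ ((s - 2^-1) - 1))%:E)%E).
  rewrite integral_mkcond [leRHS]integral_mkcond; apply: le_ge0_integral => t; rewrite /patch.
    by case: ifPn => // _; rewrite lee_fin g0.
  case: ifPn => [/set_mem|_]; last by case: ifPn => // _; rewrite lee_fin powR_ge0.
  rewrite /= in_itv/= => /andP[t1 tn]; rewrite mem_set; last by rewrite /= in_itv/= (ltW t1).
  have -> : s - 2^-1 - 1 = (s - 1) - 2^-1 by ring.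
  have t0 : 0 < t by exact: lt_trans t1.
  rewrite lee_fin powRD; last by rewrite (gt_eqF t0) implybT.
  by apply: ler_wpM2l; rewrite ?powR_ge0// ge_min lexx orbT.
have ss : s - 2^-1 != 0 by rewrite subr_eq0 lt_eqF.
rewrite integral_powR// lee_fin powR1.
have -> x : (x - 1) / (s - 2^-1) = (1 - x) / (2^-1 - s).
  by rewrite -(opprB s) invrN mulrN -mulNr opprB.
by rewrite ler_pdivrMr// mulVf ?gt_eqF// gerBl powR_ge0.
Qed.

End power_integrals.

Section lorentz_interpolation.
Context (R : realType) d (T : measurableType d) (m : {measure set T -> \bar R}).

(** The rearrangement at t is at most S because |h| <= S, and at most
    S t^(-1/2) by the weak-type bound at a = S t^(-1/2). *)
Lemma lorentz_norm1_le (h : T -> R[i]) (S q : R) : 0 < S -> 2 < q ->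
  (forall x, normc (h x) <= S) ->
  (forall a : R, 0 < a -> (distribution_function m h a <= (S ^+ 2 / a ^+ 2)%:E)%E) ->
  (lorentz_norm m q%:E 1%:E h <= ((q + (2^-1 - q^-1)^-1) * S)%:E)%E.
Proof.
move=> S0 q2 hS hw; have q0 : 0 < q by exact: lt_trans q2.
have rearr_le t : 0 < t ->
    (rearrangement m h t <= (S * Num.min 1 (t `^ (- 2^-1)))%:E)%E.
  move=> t0; case: (leP 1 (t `^ (- 2^-1))) => _; rewrite ?mulr1.
    apply: ereal_inf_lbound; exists S => //; split => //.
    rewrite /distribution_function (_ : [set _ | _] = set0) ?measure0 ?lee_fin ?ltW//.
    by apply/seteqP; split => // x /=; rewrite ltNge hS.
  have p0 : 0 < t `^ (- 2^-1) by rewrite powR_gt0.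
  apply: ereal_inf_lbound; exists (S * t `^ (- 2^-1)) => //; split; first exact: mulr_gt0.
  apply: le_trans (hw _ (mulr_gt0 S0 p0)) _; rewrite lee_fin exprMn.
  rewrite powRN (powR12_sqrt (ltW t0)) exprVn (sqr_sqrtr (ltW t0)).
  by rewrite le_eqVlt; apply/orP; left; apply/eqP; field; rewrite !gt_eqF.
rewrite lorentz_norm1E ?gt_eqF//.
apply: (@le_trans _ _ (\int[lebesgue_measure]_(t in `]0%R, +oo[)
    (S%:E * (t `^ (q^-1 - 1) * Num.min 1 (t `^ (- 2^-1)))%:E))%E).
  apply: le_ge0_integral_in => t; rewrite /= in_itv/= andbT => t0.
    apply: mule_ge0; last by rewrite lee_fin invr_ge0 ltW.
    apply: mule_ge0; first by rewrite lee_fin powR_ge0.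
    by apply: le_ereal_inf_tmp => _ [a [a0 _] <-]; rewrite lee_fin ltW.
  have -> : t `^ (q^-1 - 1) = t `^ q^-1 * t^-1.
    by rewrite powRB ?(gt_eqF t0) ?implybT// (powRr1 (ltW t0)).
  rewrite muleAC -EFinM.
  apply: (@le_trans _ _ ((t `^ q^-1 / t)%:E * (S * Num.min 1 (t `^ (- 2^-1)))%:E)%E).
    apply: lee_wpmul2l; last exact: rearr_le.
    by rewrite lee_fin mulr_ge0 ?powR_ge0// invr_ge0 ltW.
  by rewrite -!EFinM lee_fin mulrCA.
rewrite ge0_integralZl_EFin//; last 3 first.
- by move=> t _; rewrite lee_fin mulr_ge0 ?powR_ge0// le_min ler01 powR_ge0.
- apply/measurable_EFinP; apply: measurable_funTS; apply: measurable_funM.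
    exact: measurable_powR.
  by apply: measurable_minr => //; exact: measurable_powR.
- exact: ltW.
rewrite mulrC EFinM; apply: lee_wpmul2l; first by rewrite lee_fin ltW.
rewrite -{2}(invrK q); apply: integral_min_powR; first by rewrite invr_gt0.
by rewrite ltf_pV2 ?posrE.
Qed.

End lorentz_interpolation.

(** * Borel functions and density of C_c in L^2 *)

Section borel.
Context (R : realType) (X : topologicalType) (x0 : X).

Lemma open_borel (U : set X) : open U -> measurable (U : set (borel x0)).
Proof. by move=> oU; exact: sub_sigma_algebra. Qed.

Lemma closed_borel (F : set X) : closed F -> measurable (F : set (borel x0)).
Proof.
move=> cF; rewrite -(setCK F); apply: measurableC.
by apply: open_borel; exact: closed_openC.
Qed.

Lemma continuous_borel (f : X -> R) : continuous f ->
  measurable_fun [set: borel x0] f.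
Proof.
move=> cf; apply: (measurability _ (RGenOpens.measurableE R)).
move=> _ [_ [a [b ->] <-]]; rewrite setTI; apply: open_borel.
by apply: (iffLR (continuousP f)) => //; exact: interval_open.
Qed.

End borel.

Section density.
Context (R : realType) (X : topologicalType) (x0 : X).
Variable mu : {measure set (borel x0) -> \bar R}.
Hypothesis hX : hausdorff_space X.
Hypothesis lX : locally_compact [set: X].
Hypothesis rmu : radon mu.
Local Open Scope ereal_scope.

Lemma radon_outer (E : set (borel x0)) (e : R) : measurable E -> mu E < +oo ->
  (0 < e)%R -> exists U : set X, [/\ open U, E `<=` U & mu U <= mu E + e%:E].
Proof.
move=> mE Eoo e0; have [_ outer _] := rmu.
have Efin : mu E \is a fin_num by rewrite ge0_fin_numE.
have : ereal_inf [set mu U | U in [set U : set X | open U /\ E `<=` U]]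
    \is a fin_num by rewrite -outer.
move=> /(lb_ereal_inf_adherent e0)[_ [U [oU EU] <-]].
by rewrite -outer// => /ltW; exists U.
Qed.

Lemma radon_inner (U : set X) (r : R) : open U -> r%:E < mu U ->
  exists K : set X, [/\ compact K, K `<=` U & r%:E < mu K].
Proof.
move=> oU; have [_ _ inner] := rmu; rewrite inner//.
by move=> /ereal_sup_gt[_ [K [cK KU] <-] rK]; exists K.
Qed.

(** Distances are measured by squared L^2 norms, which avoids roots. *)
Definition Cc_approx (f : borel x0 -> R) := forall e : R, (0 < e)%R ->
  exists h : X -> R, [/\ continuous h, compact_support h &
    \int[mu]_x ((f x - h x) ^+ 2)%:E <= e%:E].

Lemma Cc_approx_trans (f : borel x0 -> R) : measurable_fun setT f ->
  (forall e : R, (0 < e)%R -> exists g : borel x0 -> R,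
     [/\ measurable_fun setT g, Cc_approx g &
       \int[mu]_x ((f x - g x) ^+ 2)%:E <= e%:E]) -> Cc_approx f.
Proof.
move=> mf fg e e0; have e4 : (0 < e / 4)%R by rewrite divr_gt0.
have [g [mg ag fge]] := fg _ e4; have [h [ch sh ghe]] := ag _ e4.
exists h; split => //.
have mh : measurable_fun [set: borel x0] h by exact: continuous_borel.
have mfg : measurable_fun setT (fun x => f x - g x)%R by exact: measurable_funB.
have mgh : measurable_fun setT (fun x => g x - h x)%R by exact: measurable_funB.
have -> : \int[mu]_x ((f x - h x) ^+ 2)%:E =
    \int[mu]_x (((f x - g x) + (g x - h x)) ^+ 2)%:E.
  by apply: eq_integral => x _; congr EFin; ring.
apply: le_trans (integral_sqrD_le mu mfg mgh) _.
apply: (@le_trans _ _ (2%:E * (e / 4)%:E + 2%:E * (e / 4)%:E)).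
  by apply: leeD; apply: lee_wpmul2l.
by rewrite -EFinM -EFinD lee_fin; lra.
Qed.

Lemma Cc_approxD (f g : borel x0 -> R) : measurable_fun setT f ->
  measurable_fun setT g -> Cc_approx f -> Cc_approx g ->
  Cc_approx (fun x => f x + g x)%R.
Proof.
move=> mf mg af ag e e0; have e4 : (0 < e / 4)%R by rewrite divr_gt0.
have [h [ch sh fhe]] := af _ e4; have [k [ck sk gke]] := ag _ e4.
exists (fun x => h x + k x)%R; split.
- by move=> x; apply: continuousD; [exact: ch|exact: ck].
- apply: (compact_supportP hX (compactU sh sk)) => x hkx.
  have [hx kx] : h x = 0%R /\ k x = 0%R.
    by split; apply: compact_support0 => ?; apply: hkx; [left|right].
  by rewrite hx kx addr0.
have mfh : measurable_fun setT (fun x => f x - h x)%R.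
  by apply: measurable_funB => //; exact: continuous_borel.
have mgk : measurable_fun setT (fun x => g x - k x)%R.
  by apply: measurable_funB => //; exact: continuous_borel.
have -> : \int[mu]_x ((f x + g x - (h x + k x)) ^+ 2)%:E =
    \int[mu]_x (((f x - h x) + (g x - k x)) ^+ 2)%:E.
  by apply: eq_integral => x _; congr EFin; ring.
apply: le_trans (integral_sqrD_le mu mfh mgk) _.
apply: (@le_trans _ _ (2%:E * (e / 4)%:E + 2%:E * (e / 4)%:E)).
  by apply: leeD; apply: lee_wpmul2l.
by rewrite -EFinM -EFinD lee_fin; lra.
Qed.

Lemma Cc_approxZ (c : R) (f : borel x0 -> R) : measurable_fun setT f ->
  Cc_approx f -> Cc_approx (fun x => c * f x)%R.
Proof.
move=> mf af e e0; have c20 : (0 < c ^+ 2 + 1)%R by rewrite ltr_wpDl ?sqr_ge0.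
have [h [ch sh fhe]] := af _ (divr_gt0 e0 c20).
exists (fun x => c * h x)%R; split.
- by move=> x; apply: cvgMl_tmp; exact: ch.
- apply: (compact_supportP hX sh) => x /compact_support0 ->.
  by rewrite mulr0.
have -> : \int[mu]_x ((c * f x - c * h x) ^+ 2)%:E =
    \int[mu]_x ((c ^+ 2)%:E * ((f x - h x) ^+ 2)%:E).
  by apply: eq_integral => x _; rewrite -EFinM; congr EFin; ring.
rewrite ge0_integralZl_EFin ?sqr_ge0//; last 2 first.
- by move=> x _; rewrite lee_fin sqr_ge0.
- apply/measurable_EFinP/measurable_funX; apply: measurable_funB => //.
  exact: continuous_borel.
apply: le_trans (lee_wpmul2l _ fhe) _; first by rewrite lee_fin sqr_ge0.
rewrite -EFinM lee_fin mulrCA ger_pMr// ler_pdivrMr// mul1r.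
by rewrite lerDl.
Qed.

(** Choose an open U containing E and a compact K inside U with mu U close to both
    mu E and mu K.  A function equal to 1 on K and 0 off U differs from the indicator
    of E only on U \ E and U \ K. *)
Lemma Cc_approx_indic (E : set (borel x0)) : measurable E -> mu E < +oo ->
  Cc_approx \1_E.
Proof.
move=> mE Eoo e e0; have e2 : (0 < e / 2)%R by rewrite divr_gt0.
have Efin : mu E \is a fin_num by rewrite ge0_fin_numE.
have [U [oU EU UE]] := radon_outer mE Eoo e2.
have Ufin : mu U \is a fin_num.
  by rewrite ge0_fin_numE//; apply: le_lt_trans UE _; rewrite lte_add_pinfty// ltry.
have mU : measurable (U : set (borel x0)) by exact: open_borel.
have [] := @radon_inner U (fine (mu U) - e / 2)%R oU.
  by rewrite -[ltRHS]fineK// lte_fin; lra.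
move=> K [cK KU UK].
have mK : measurable (K : set (borel x0)).
  by apply: closed_borel; exact: compact_closed.
have Kfin : mu K \is a fin_num.
  rewrite ge0_fin_numE// (le_lt_trans (le_measure mu _ _ KU)) ?inE//.
  by rewrite ltey_eq Ufin.
have [phi [cphi phi01 phiK phiU sphi]] := urysohn_compact R hX lX cK oU KU.
exists phi; split => //.
apply: (@le_trans _ _ (\int[mu]_x ((\1_(U `\` E) x)%:E + (\1_(U `\` K) x)%:E))).
  apply: le_ge0_integral => x; rewrite lee_fin ?sqr_ge0//.
  rewrite !indicE !in_setD.
  have [xU|xU] := boolP (x \in U); last first.
    rewrite (phiU x); last by move/mem_set; apply/negP.
    have -> : x \in E = false.
      by apply/negP => /set_mem/EU/mem_set; apply/negP.
    by rewrite /= subr0 expr0n/= !addr0.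
  have /andP[p0 p1] := phi01 x.
  have [xE|xE] := boolP (x \in E); have [/set_mem/phiK ->|xK] := boolP (x \in K);
    rewrite /= ?subrr ?expr0n ?sub0r ?sqrrN ?expr1n ?add0r ?addr0//; nra.
rewrite ge0_integralD//; last 2 first.
- by apply/measurable_EFinP/measurable_indic/measurableD.
- by apply/measurable_EFinP/measurable_indic/measurableD.
rewrite !integral_indic//; [|exact: measurableD..].
rewrite !setIT !measureD//; try by rewrite -ge0_fin_numE.
rewrite !(setIidr) //.
have [[u Eu] [c Ec] [k Ek]] : [/\ exists u, mu U = u%:E, exists c, mu E = c%:E &
    exists k, mu K = k%:E].
  by split; eexists; rewrite -[LHS]fineK.
move: UE UK; rewrite Eu Ec Ek /=.
set lhs := (X in _ -> _ -> X <= _).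
have -> : lhs = u%:E - c%:E + (u%:E - k%:E) by congr (_ - _ + (_ - _)).
rewrite -!EFinB -!EFinD !lee_fin lte_fin; lra.
Qed.

Lemma Cc_approx0 : Cc_approx (fun=> 0%R).
Proof.
move=> e e0; exists (fun=> 0%R); split.
- by move=> x; exact: cst_continuous.
- by apply: (compact_supportP hX (@compact0 X)).
- under eq_integral do rewrite subrr expr0n.
  by rewrite integral0 lee_fin ltW.
Qed.

Lemma Cc_approx_sum (I : Type) (s : seq I) (f : I -> borel x0 -> R) :
  (forall i, measurable_fun setT (f i)) -> (forall i, Cc_approx (f i)) ->
  Cc_approx (fun x => \sum_(i <- s) f i x)%R.
Proof.
move=> mf af; elim: s => [|i s IH].
  by under eq_fun do rewrite big_nil; exact: Cc_approx0.
under eq_fun do rewrite big_cons; apply: Cc_approxD => //.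
exact: measurable_sum.
Qed.

(** The staircases of f converge to f in L^2 by dominated convergence, and their
    superlevel sets have finite measure by Chebyshev's inequality. *)
Lemma Cc_approx_ge0 (f : borel x0 -> R) : measurable_fun setT f ->
  (forall x, 0 <= f x)%R -> \int[mu]_x (f x ^+ 2)%:E < +oo -> Cc_approx f.
Proof.
move=> mf f0 foo.
have mlevel (a : R) : measurable [set x | (a < f x)%R].
  exact: measurable_superlevel.
have level_oo (a : R) : (0 < a)%R -> mu [set x | (a < f x)%R] < +oo.
  move=> a0; have a20 : (0 < a ^+ 2)%R by rewrite exprn_gt0.
  rewrite -(@lte_pmul2l _ (a ^+ 2)%:E)// mulry gtr0_sg// mul1e.
  apply: le_lt_trans foo.
  rewrite -[X in mu X]setIT -integral_indic// -ge0_integralZl_EFin//.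
  - apply: le_ge0_integral => x.
      by rewrite mule_ge0// lee_fin// sqr_ge0.
    rewrite -EFinM lee_fin indicE.
    have [/set_mem/= ax|_] := boolP (x \in _); last by rewrite mulr0 sqr_ge0.
    by rewrite mulr1 lerXn2r ?nnegrE//; exact: ltW.
  - by apply/measurable_EFinP/measurable_indic.
  - exact: ltW.
have ms n : measurable_fun setT (fun x => staircase n (f x)).
  exact: measurable_staircase.
have as_ n : Cc_approx (fun x => staircase n (f x)).
  rewrite staircase_indic; apply: Cc_approx_sum => k.
    by apply: measurable_funM => //; exact: measurable_indic.
  apply: Cc_approxZ; first exact: measurable_indic.
  by apply: Cc_approx_indic => //; apply: level_oo; rewrite divr_gt0.
apply: Cc_approx_trans => // e e0.
have : \int[mu]_x ((f x - staircase n (f x)) ^+ 2)%:E @[n --> \oo] --> 0.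
  have [] := @dominated_convergence _ _ _ mu setT measurableT
      (fun n x => ((f x - staircase n (f x)) ^+ 2)%:E) (cst 0)
      (fun x => (f x ^+ 2)%:E) => //.
  - move=> n; apply/measurable_EFinP/measurable_funX.
    exact: measurable_funB.
  - apply: aeW => x _; apply: cvg_EFin; first exact: nearW.
    have cB : (f x - staircase n (f x))%R @[n --> \oo] --> (f x - f x)%R.
      by apply: cvgB; [exact: cvg_cst|exact: cvg_staircase].
    under eq_fun do rewrite expr2.
    by have := cvgM cB cB; rewrite subrr mulr0; apply.
  - apply/integrableP; split; first exact/measurable_EFinP/measurable_funX.
    by under eq_integral do rewrite gee0_abs ?lee_fin ?sqr_ge0//.
  - apply: aeW => x n _; rewrite gee0_abs ?lee_fin ?sqr_ge0//.
    rewrite ler_pXn2r ?nnegrE ?subr_ge0 ?staircase_le//.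
    by rewrite gerBl staircase_ge0.
  - by move=> _ _; rewrite integral0.
move=> /(_ [set y | y < e%:E])[].
  apply: open_nbhs_nbhs; split; first exact: open_ereal_lt_ereal.
  by rewrite /= lte_fin.
move=> n _ /(_ n (leqnn n))/= fn.
by exists (fun x => staircase n (f x)); split => //; exact: ltW.
Qed.

Lemma Cc_dense (f : borel x0 -> R) : measurable_fun setT f ->
  \int[mu]_x (f x ^+ 2)%:E < +oo -> Cc_approx f.
Proof.
move=> mf foo.
have -> : f = (fun x => Num.max (f x) 0 + (-1) * Num.max (- f x) 0)%R.
  apply/funext => x; rewrite mulN1r; case: (ltP (f x) 0%R); case: (ltP (- f x)%R 0%R); lra.
have mp : measurable_fun setT (fun x => Num.max (f x) 0)%R.
  exact: measurable_maxr.
have mn : measurable_fun setT (fun x => Num.max (- f x) 0)%R.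
  by apply: measurable_maxr => //; exact: measurable_funN.
apply: Cc_approxD => //; first exact: measurable_funM.
- apply: Cc_approx_ge0 => //; first by move=> x; rewrite le_max lexx orbT.
  apply: le_lt_trans foo; apply: le_ge0_integral => x; rewrite lee_fin ?sqr_ge0//.
  by case: (ltP (f x) 0%R) => _ //; rewrite expr0n sqr_ge0.
- apply: Cc_approxZ => //.
  apply: Cc_approx_ge0 => //; first by move=> x; rewrite le_max lexx orbT.
  apply: le_lt_trans foo; apply: le_ge0_integral => x; rewrite lee_fin ?sqr_ge0//.
  by case: (ltP (- f x)%R 0%R) => _; rewrite ?sqrrN// expr0n sqr_ge0.
Qed.

End density.

(** * Haar measures *)

Section topological_group.
Context (G : topologicalZmodType).

Lemma translate_continuous (x : G) : continuous (fun y : G => y + x).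
Proof.
move=> y.
apply: (@continuous_comp _ _ _ (fun z : G => (z, x)) (fun z => z.1 + z.2)).
  by apply: cvg_pair; [exact: cvg_id|exact: cvg_cst].
exact: add_continuous.
Qed.

Lemma translate_nbhs (x : G) (D : set G) : nbhs 0 D ->
  nbhs x [set y | D (y - x)].
Proof. by move=> D0; apply: (@translate_continuous (- x) x D); rewrite /= subrr. Qed.

End topological_group.

Section haar_locally_compact.
Context (R : realType) (G : topologicalZmodType).
Variable mu : {measure set (borel (0 : G)) -> \bar R}.
Hypothesis hG : hausdorff_space G.
Hypothesis hmu : haar mu.

(** Steinhaus' argument.  Take a compact K of positive measure and an open U
    containing K with mu U < 2 mu K.  For w near 0 the translate of K by w lies in U,
    hence meets K: so K - K is a compact neighbourhood of 0. *)
Lemma haar_locally_compact : locally_compact [set: G].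
Proof.
have [rmu mu0 muD] := hmu.
have [cptoo _ _] := rmu.
have [K [cK _ K0]] : exists K : set G, [/\ compact K, K `<=` setT & (0%:E < mu K)%E].
  by apply: (radon_inner rmu openT); rewrite lt0e mu0 measure_ge0.
have mK : measurable (K : set (borel (0 : G))).
  by apply: closed_borel; exact: compact_closed.
have Kfin : (mu K \is a fin_num)%E by rewrite ge0_fin_numE// cptoo.
have k0 : 0 < fine (mu K) by rewrite fine_gt0// K0 ltey_eq Kfin.
have [U [oU KU UK]] := radon_outer rmu mK (cptoo _ cK) (divr_gt0 k0 (ltr0n R 2)).
pose D := [set z.1 - z.2 | z in K `*` K].
have cD : compact D.
  apply: continuous_compact; last exact: compact_setX.
  by apply: continuous_subspaceT => z; exact: sub_continuous.
have D0 : nbhs (0 : G) D.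
  have : \forall w \near (0 : G), K `<=` [set x | U (x + w)].
    apply: (iffLR (compact_near_coveringP K) cK) => x Kx.
    have := @add_continuous G (x, 0) U; apply.
    by apply: open_nbhs_nbhs; split => //=; rewrite addr0; exact: KU.
  apply: filterS => w Kw.
  have [[y [Ky [x Kx xy]]]|disj] := pselect (K `&` [set w + a | a in K] !=set0).
    by exists (y, x) => //=; rewrite -xy addrK.
  exfalso; move: UK.
  pose Kw' : set (borel (0 : G)) := [set w + a | a in K].
  have mKw : measurable Kw'.
    apply: closed_borel; apply: compact_closed => //.
    apply: continuous_compact => //; apply: continuous_subspaceT => x.
    rewrite (_ : +%R w = +%R^~ w); first exact: translate_continuous.
    by apply/funext => z; rewrite addrC.
  have : (mu (K `|` Kw') <= mu U)%E.
    apply: le_measure; rewrite ?inE.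
    - exact: measurableU.
    - exact: open_borel.
    - by move=> z [/KU//|[x /Kw xw <-]]; rewrite addrC.
  rewrite measureU//; last first.
    by apply/eqP/negPn/negP => /set0P.
  have muK : mu K = (fine (mu K))%:E by rewrite fineK.
  have muKw : mu Kw' = (fine (mu K))%:E by rewrite -muK; exact: muD.
  move=> /le_trans /[apply].
  rewrite [X in (X + _ <= _)%E]muK [X in (_ + X <= _)%E]muKw.
  rewrite [X in (_ <= X + _)%E]muK -!EFinD lee_fin.
  by move: k0; lra.
move=> x _; exists [set y | D (y - x)]; first by rewrite withinET; exact: translate_nbhs.
have -> : [set y | D (y - x)] = [set z + x | z in D].
  apply/seteqP; split => [y Dy|_ [z Dz <-]] /=; last by rewrite addrK.
  by exists (y - x) => //; rewrite subrK.
have cDx : compact [set z + x | z in D].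
  by apply: continuous_compact => //; apply: continuous_subspaceT; exact: translate_continuous.
by split => //; exact: compact_closed.
Qed.

End haar_locally_compact.

(** Characters that differ at a point x are separated by their values at x. *)
Lemma character_hausdorff (R : realType) (G : topologicalZmodType) :
  hausdorff_space (character R G).
Proof.
move=> xi eta h; apply: character_ext => x; apply/eqP; rewrite -subr_eq0.
apply/negP => /negP xe; have e0 : 0 < `|xi x - eta x| / 2 by rewrite divr_gt0// normr_gt0.
have cx := @compact_set1 G x.
have [zeta [/= /(_ x erefl) z1 /(_ x erefl) z2]] :=
  h _ _ (char_nbhs xi cx e0) (char_nbhs eta cx e0).
have : `|xi x - eta x| < `|xi x - eta x|.
  rewrite distrC in z2; rewrite [ltRHS]splitr.
  by apply: le_lt_trans (ltrD z1 z2); exact: ler_distD.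
by rewrite ltxx.
Qed.

Section compactness.

(** A property of sets that is local, hereditary and stable under finite unions holds
    for compact sets: otherwise the complements of the sets with the property
    generate a proper filter on K without cluster point. *)
Lemma compact_induction (X : topologicalType) (K : set X) (P : set X -> Prop) :
  compact K -> P set0 -> (forall A B, P A -> P B -> P (A `|` B)) ->
  (forall A B, A `<=` B -> P B -> P A) ->
  (forall x, K x -> exists2 U, nbhs x U & P U) -> P K.
Proof.
move=> cK P0 PU PS Ploc; apply: contrapT => nPK.
pose F (A : set X) := exists2 B, P B & K `\` B `<=` A.
have FF : ProperFilter F.
  apply: Build_ProperFilter_ex.
    move=> A [B PB KBA]; apply: contrapT => nA; apply: nPK.
    apply: (PS _ B) => // x Kx; apply: contrapT => nBx.
    by apply: nA; exists x; exact: KBA.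
  split.
  - by exists set0.
  - move=> A A' [B PB BA] [B' PB' BA']; exists (B `|` B'); first exact: PU.
    by move=> x [Kx /not_orP[nB nB']]; split; [exact: BA|exact: BA'].
  - by move=> A A' AA' [B PB BA]; exists B => // x /BA; exact: AA'.
have [|x [Kx clx]] := cK F FF; first by exists set0 => // x [].
have [U xU PU'] := Ploc x Kx.
have FU : F (~` U) by exists U => // y [].
by have [y []] := clx _ _ FU xU.
Qed.

Lemma compact_support_bounded (R : realType) (X : topologicalType) (u : X -> R) :
  continuous u -> compact_support u ->
  exists2 M, 0 < M & forall x, `|u x| <= M.
Proof.
move=> cu su; have : bounded_set (u @` closure [set x | u x != 0]).
  apply: compact_bounded; apply: continuous_compact => //.
  exact: continuous_subspaceT.
move=> /ex_strict_bound_gt0 [M M0 uM]; exists M => // x.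
have [/compact_support0 ->|/contrapT clx] := pselect (~ closure [set x | u x != 0] x).
  by rewrite normr0 ltW.
by apply/ltW/uM; exists x.
Qed.

End compactness.

Section radon_Cc.
Context (R : realType) (X : topologicalType) (x0 : X).
Variable mu : {measure set (borel x0) -> \bar R}.
Hypothesis cpt_oo : forall K : set X, compact K -> (mu K < +oo)%E.

Lemma integral_Cc_lty (u : X -> R) : continuous u -> compact_support u ->
  (\int[mu]_x `|u x|%:E < +oo)%E.
Proof.
move=> cu su; have [M M0 uM] := compact_support_bounded cu su.
pose K := closure [set x | u x != 0]; have mK : measurable (K : set (borel x0)).
  by apply: closed_borel; exact: closed_closure.
apply: (@le_lt_trans _ _ (\int[mu]_x (M%:E * (\1_K x)%:E))%E).
  apply: le_ge0_integral => x; rewrite -?EFinM lee_fin//.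
  rewrite indicE; have [_|/negP nKx] := boolP (x \in K); first by rewrite mulr1.
  rewrite (_ : u x = 0) ?normr0 ?mulr0//; apply: compact_support0 => Kx.
  by apply: nKx; exact: mem_set.
rewrite ge0_integralZl_EFin//; last 2 first.
- by apply/measurable_EFinP; exact: measurable_indic.
- exact: ltW.
by rewrite integral_indic// setIT lte_mul_pinfty// ?lee_fin ?ltW// cpt_oo.
Qed.

End radon_Cc.

Section translation_invariance.
Context (R : realType) (G : topologicalZmodType).
Variable mu : {measure set (borel (0 : G)) -> \bar R}.
Hypothesis muD : forall (x : G) (A : set (borel (0 : G))), measurable A ->
  mu [set (x + a)%R | a in (A : set G)] = mu A.

Lemma translate_measurable (x : G) :
  measurable_fun [set: borel (0 : G)] (fun y : borel (0 : G) => (y + x : borel (0 : G))).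
Proof.
have gen : @measurable _ (borel (0 : G)) = <<s @open (pointed_at (0 : G)) >> by [].
apply: (@measurability _ _ (borel (0 : G)) (borel (0 : G)) setT _ _ gen).
move=> _ [U oU <-]; rewrite setTI; apply: open_borel.
by apply: (iffLR (continuousP (fun y : G => y + x))) => //; exact: translate_continuous.
Qed.

Lemma ge0_integral_translate (x : G) (h : borel (0 : G) -> \bar R) :
  measurable_fun setT h -> (forall y, 0 <= h y)%E ->
  (\int[mu]_y h (y + x)%R = \int[mu]_y h y)%E.
Proof.
move=> mh h0.
have <- := @ge0_integral_pushforward _ _ _ _ R _ (translate_measurable x) mu setT h
  measurableT mh (fun y _ => h0 y).
apply: eq_measure_integral; first exact: translate_measurable.
move=> mphi A mA _.
rewrite /= /pushforward -(muD (- x) mA); congr (mu _).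
apply/seteqP; split => [y Ay|_ [a Aa <-]] /=; last by rewrite addrAC addNr add0r.
by exists (y + x) => //; rewrite addrCA addNr addr0.
Qed.

End translation_invariance.

(** * A double integral over the group *)

Section convolution.
Context (R : realType) (G : topologicalZmodType).
Variable mu : {measure set (borel (0 : G)) -> \bar R}.
Hypothesis hG : hausdorff_space G.
Hypothesis hmu : haar mu.
Local Open Scope ereal_scope.

Let cpt_oo (K : set G) : compact K -> mu K < +oo.
Proof. by have [[h _ _] _ _] := hmu; exact: h. Qed.

Let muD (x : G) (A : set (borel (0 : G)%R)) : measurable A ->
  mu [set (x + a)%R | a in (A : set G)] = mu A.
Proof. by have [_ _ h] := hmu; exact: h. Qed.

Variables u v : G -> R.
Hypotheses (cu : continuous u) (cv : continuous v).
Hypotheses (su : compact_support u) (sv : compact_support v).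
Hypotheses (u0 : forall x, (0 <= u x)%R) (v0 : forall x, (0 <= v x)%R).

Let mv : measurable_fun [set: borel (0 : G)%R] (EFin \o v).
Proof. by apply/measurable_EFinP; exact: continuous_borel. Qed.

Let cut (y : G) : continuous (fun x => u (y + x)%R).
Proof.
move=> x; apply: (@continuous_comp _ _ _ (fun x : G => y + x)%R u); last exact: cu.
rewrite (_ : (fun _ => _) = +%R^~ y); first exact: translate_continuous.
by apply/funext => z; rewrite addrC.
Qed.

Let K := closure [set x | v x != 0%R].
Let L := closure [set x | u x != 0%R].
Let H := [set (z.1 - z.2)%R | z in L `*` K].

Let cH : compact H.
Proof.
apply: continuous_compact; last exact: compact_setX.
by apply: continuous_subspaceT => z; exact: sub_continuous.
Qed.

Let mH : measurable (H : set (borel (0 : G)%R)).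
Proof. by apply: closed_borel; exact: compact_closed. Qed.

Let mK : measurable (K : set (borel (0 : G)%R)).
Proof. by apply: closed_borel; exact: closed_closure. Qed.

Let integral_ut (y : G) : \int[mu]_x (u (y + x)%R)%:E = \int[mu]_x (u x)%:E.
Proof.
under eq_integral do rewrite addrC.
rewrite (@ge0_integral_translate R G mu muD y (EFin \o u))//.
by apply/measurable_EFinP; exact: continuous_borel.
Qed.

Variable e : R.
Hypothesis e0 : (0 < e)%R.

Let near_translate (y0 : G) : exists2 U : set G, open U /\ U y0 &
  forall y x, U y -> K y -> (u (y + x) <= u (y0 + x) + e * \1_H x)%R.
Proof.
have : nbhs y0 [set y | H `<=` [set x | (u (y + x) - u (y0 + x) < e)%R]].
  apply: (iffLR (compact_near_coveringP H) cH) => x Hx.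
  pose F (z : G * G) : R := (u (z.2 + z.1) - u (y0 + z.1))%R.
  have cF : continuous F.
    move=> z; apply: continuousB.
      apply: (@continuous_comp _ _ _ (fun z : G * G => z.2 + z.1)%R u); last exact: cu.
      rewrite (_ : (fun _ => _) = (fun z => z.1 + z.2)%R); first exact: add_continuous.
      by apply/funext => -[a b] /=; rewrite addrC.
    apply: (@continuous_comp _ _ _ (fst : G * G -> G) (fun x => u (y0 + x)%R)).
      exact: cvg_fst.
    exact: cut.
  apply: (cF (x, y0) [set r | (r < e)%R]).
  by apply: lt_nbhsl; rewrite /F /= subrr.
rewrite nbhsE => -[U [oU Uy0] UH]; exists U => // y x Uy Ky.
rewrite indicE; have [/set_mem Hx|/negP nHx] := boolP (x \in H).
  by rewrite mulr1 -lerBlDl; apply: ltW; exact: (UH y Uy x Hx).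
rewrite mulr0 addr0 (_ : u (y + x)%R = 0%R)//; apply: compact_support0 => Lyx.
apply: nHx; apply: mem_set; exists ((y + x)%R, y) => //=.
by rewrite addrC addrA addNr add0r.
Qed.

(** The inner integral over B need not be a measurable function of x; a measurable
    majorant w makes the bounds for disjoint sets additive. *)
Let majorized (B : set (borel (0 : G)%R)) := exists w : borel (0 : G)%R -> \bar R,
  [/\ measurable_fun setT w, (forall x, 0 <= w x),
    (forall x, \int[mu]_(y in B) (u (y + x)%R * v y)%:E <= w x) &
    \int[mu]_x w x <=
      (\int[mu]_x (u x)%:E + e%:E * mu H) * \int[mu]_(y in B) (v y)%:E].

Let muvt (x : G) : measurable_fun [set: borel (0 : G)%R]
  (fun y : borel (0 : G)%R => (u (y + x) * v y)%:E).
Proof.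
apply/measurable_EFinP; apply: measurable_funM; last exact: continuous_borel.
rewrite (_ : (fun _ => _) = (fun y => u (x + y)%R)); first exact: continuous_borel.
by apply/funext => y; rewrite addrC.
Qed.

Let majorizedU (A B : set (borel (0 : G)%R)) : measurable A -> measurable B ->
  [disjoint A & B] -> majorized A -> majorized B -> majorized (A `|` B).
Proof.
move=> mA mB AB [w [mw w0 Aw wA]] [z [mz z0 Bz zB]].
exists (fun x => w x + z x); split.
- exact: emeasurable_funD.
- by move=> x; exact: adde_ge0.
- move=> x; rewrite ge0_integral_setU//; first exact: leeD.
    by apply: measurable_funTS; exact: muvt.
  by move=> y _; rewrite lee_fin mulr_ge0.
- rewrite ge0_integralD// ge0_integral_setU//; last 2 first.
  + by apply: measurable_funTS; exact: mv.
  + by move=> y _; rewrite lee_fin.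
  rewrite ge0_muleDr; first exact: leeD.
    by apply: integral_ge0 => y _; rewrite lee_fin.
  by apply: integral_ge0 => y _; rewrite lee_fin.
Qed.

Let majorized_piece (y0 : G) (U : set G) (B : set (borel (0 : G)%R)) :
  (forall y x, U y -> K y -> (u (y + x) <= u (y0 + x) + e * \1_H x)%R) ->
  measurable B -> B `<=` (K `&` U) -> majorized B.
Proof.
move=> uU mB BU; set I := \int[mu]_(y in B) (v y)%:E.
have I0 : 0 <= I by apply: integral_ge0 => y _; rewrite lee_fin.
pose c x := (u (y0 + x) + e * \1_H x)%R.
have c0 x : (0 <= c x)%R by rewrite addr_ge0// mulr_ge0// ltW.
have mu1 : measurable_fun [set: borel (0 : G)%R] (fun x : borel (0 : G)%R => u (y0 + x)%R).
  exact: continuous_borel.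
have me1 : measurable_fun [set: borel (0 : G)%R] (fun x : borel (0 : G)%R => e * \1_H x)%R.
  by apply: measurable_funM => //; exact: measurable_indic.
have mc : measurable_fun [set: borel (0 : G)%R] (EFin \o c).
  by apply/measurable_EFinP; exact: measurable_funD.
exists (fun x => (c x)%:E * I); split.
- exact: emeasurable_funM.
- by move=> x; rewrite mule_ge0 ?lee_fin.
- move=> x; rewrite -ge0_integralZl_EFin//; last 2 first.
  + by move=> y _; rewrite lee_fin.
  + by apply: measurable_funTS; exact: mv.
  apply: le_ge0_integral_in => y By; first by rewrite lee_fin mulr_ge0.
  rewrite -EFinM lee_fin; apply: ler_wpM2r => //.
  by have [Ky Uy] := BU _ By; exact: uU.
- rewrite ge0_integralZr//; last by move=> x _; rewrite lee_fin.
  apply: lee_wpmul2r => //; rewrite /c; under eq_integral do rewrite EFinD EFinM.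
  rewrite ge0_integralD//; last 4 first.
  + by move=> x _; rewrite lee_fin.
  + exact/measurable_EFinP.
  + by move=> x _; rewrite -EFinM lee_fin mulr_ge0// ltW.
  + by under eq_fun do rewrite -EFinM; exact/measurable_EFinP.
  rewrite integral_ut leeD2l// ge0_integralZl_EFin//; last 2 first.
  + by apply/measurable_EFinP; exact: measurable_indic.
  + exact: ltW.
  by rewrite integral_indic// setIT.
Qed.

Let majorizedK : majorized K.
Proof.
pose P (A : set G) := exists2 A', measurable (A' : set (borel (0 : G)%R)) /\ A `<=` A' &
  forall B : set (borel (0 : G)%R), measurable B -> B `<=` (K `&` A') -> majorized B.
have : P K.
  apply: (compact_induction sv).
  - exists set0; first by split => //; exact: measurable0.
    move=> B _ B0; have -> : B = set0 by apply/seteqP; split => // x /B0[].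
    exists (cst 0); split => //; last by rewrite !integral_set0 mule0 integral0.
    by move=> x; rewrite integral_set0.
  - move=> A B [A' [mA' AA'] PA'] [B' [mB' BB'] PB'].
    exists (A' `|` B').
      split; first exact: measurableU.
      by move=> x [/AA'|/BB']; [left|right].
    move=> C mC CAB; rewrite -(setUIDK C A').
    have mCA : measurable (C `&` A') by exact: measurableI.
    have mCB : measurable (C `\` A') by exact: measurableD.
    apply: majorizedU => //.
    + by apply/disj_set2P; rewrite setDE setIACA setICr setI0.
    + by apply: PA' => // x [/CAB[]].
    + by apply: PB' => // x [/CAB[Kx [|]]].
  - move=> A B AB [B' [mB' BB'] PB']; exists B' => //; split => //.
    exact: subset_trans AB BB'.
  - move=> y0 _; have [U [oU Uy0] uU] := near_translate y0.
    exists U; first exact: open_nbhs_nbhs.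
    exists U; first by split => //; exact: open_borel.
    by move=> B; exact: majorized_piece uU.
by move=> [A [mA KA]]; apply => // x Kx; split => //; exact: KA.
Qed.

(** After the substitution of y + x for y in the inner integral, the error e * mu H
    comes from replacing u (y + x) by u (y0 + x) on the piece of
    the support of v around y0; H is compact and contains every x for which
    u (y + x) can be nonzero with y in the support of v. *)
Lemma convolution_integral_le_add :
  \int[mu]_x \int[mu]_y (u y * v (y - x))%:E <=
  (\int[mu]_x (u x)%:E + e%:E * mu H) * \int[mu]_y (v y)%:E.
Proof.
have [w [mw w0 Kw wK]] := majorizedK.
have vK : \int[mu]_(y in K) (v y)%:E = \int[mu]_y (v y)%:E.
  rewrite integral_mkcond; apply: eq_integral => y _; rewrite /patch.
  case: ifPn => // /negP nKy; rewrite (_ : v y = 0%R)//.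
  by apply: compact_support0 => Ky; apply: nKy; exact: mem_set.
rewrite -vK; apply: le_trans wK; apply: le_ge0_integral => x.
  by apply: integral_ge0 => y _; rewrite lee_fin mulr_ge0.
apply: le_trans (Kw x).
rewrite -(@ge0_integral_translate R G mu muD x
  (fun y => (u y * v (y - x))%:E)); last 2 first.
- apply/measurable_EFinP; apply: measurable_funM; first exact: continuous_borel.
  apply: continuous_borel => y.
  apply: (@continuous_comp _ _ _ (fun y : G => y - x)%R v); last exact: cv.
  exact: translate_continuous.
- by move=> y; rewrite lee_fin mulr_ge0.
rewrite [leRHS]integral_mkcond; apply: le_ge0_integral => y.
  by rewrite lee_fin mulr_ge0.
rewrite addrK /patch; case: ifPn => // /negP nKy.
rewrite (_ : v y = 0%R) ?mulr0//.
by apply: compact_support0 => Ky; apply: nKy; exact: mem_set.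
Qed.

End convolution.

(** Equality holds by invariance if the integrals may be exchanged; the inequality
    follows from the previous bound, without Tonelli's theorem, as the error
    tends to 0. *)
Lemma convolution_integral_le (R : realType) (G : topologicalZmodType)
    (mu : {measure set (borel (0 : G)) -> \bar R}) (u v : G -> R) :
  hausdorff_space G -> haar mu -> continuous u -> continuous v ->
  compact_support u -> compact_support v ->
  (forall x, 0 <= u x) -> (forall x, 0 <= v x) ->
  (\int[mu]_x \int[mu]_y (u y * v (y - x)%R)%:E <=
   (\int[mu]_x (u x)%:E) * \int[mu]_y (v y)%:E)%E.
Proof.
move=> hG hmu cu cv su sv u0 v0.
have [[cpt_oo _ _] _ _] := hmu.
have fin_int (w : G -> R) : continuous w -> compact_support w ->
    (forall x, 0 <= w x) -> exists2 r, (0 <= r) & (\int[mu]_x (w x)%:E)%E = r%:E.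
  move=> cw sw w0; have := integral_Cc_lty cpt_oo cw sw.
  under eq_integral do rewrite ger0_norm//.
  move=> woo; have i0 : (0 <= \int[mu]_x (w x)%:E)%E.
    by apply: integral_ge0 => x _; rewrite lee_fin.
  exists (fine (\int[mu]_x (w x)%:E)%E); first exact: fine_ge0.
  by rewrite fineK// ge0_fin_numE.
have [a a0 ua] := fin_int u cu su u0; have [b b0 vb] := fin_int v cv sv v0.
have := convolution_integral_le_add hG hmu cu cv su sv u0 v0.
set H := [set z.1 - z.2 | z in _] => conv.
have cH : compact H.
  apply: continuous_compact; last exact: compact_setX.
  by apply: continuous_subspaceT => z; exact: sub_continuous.
have Hfin : mu H \is a fin_num by rewrite ge0_fin_numE// cpt_oo.
have h0 : 0 <= fine (mu H) by exact: fine_ge0.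
rewrite ua vb; apply/lee_addgt0Pr => e e0.
have d0 : 0 < fine (mu H) * b + 1 by rewrite ltr_wpDl// mulr_ge0.
apply: le_trans (conv _ (divr_gt0 e0 d0)) _.
rewrite ua vb -(fineK Hfin) -!EFinM -!EFinD lee_fin mulrDl lerD2l -mulrA.
by rewrite -[leRHS]mulr1 -mulrA ler_pM2l// mulrC ler_pdivrMr// mul1r lerDl.
Qed.

(** * The short-time Fourier transform on L^2 *)

Section complex_continuity.
Context (R : realType).

Lemma Re_continuous : continuous (fun z : R[i]^o => complex.Re z).
Proof.
move=> z; have FF : Filter (nbhs (z : R[i]^o)) by exact: nbhs_filter.
apply/cvgrPdist_lt => e e0.
have e0' : 0 < e%:C%C by rewrite ltcR.
exists e%:C%C => //= w zw; rewrite -ltcR.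
have -> : complex.Re z - complex.Re w = complex.Re (z - w) by rewrite raddfB.
by apply: le_lt_trans zw; rewrite normrE lecR Re_le_normc.
Qed.

Lemma Im_continuous : continuous (fun z : R[i]^o => complex.Im z).
Proof.
move=> z; have FF : Filter (nbhs (z : R[i]^o)) by exact: nbhs_filter.
apply/cvgrPdist_lt => e e0.
have e0' : 0 < e%:C%C by rewrite ltcR.
exists e%:C%C => //= w zw; rewrite -ltcR.
have -> : complex.Im z - complex.Im w = complex.Im (z - w) by rewrite raddfB.
by apply: le_lt_trans zw; rewrite normrE lecR Im_le_normc.
Qed.

Definition ccontinuous (X : topologicalType) (f : X -> R[i]) :=
  continuous (fun x => complex.Re (f x)) /\
  continuous (fun x => complex.Im (f x)).

Definition cCc (X : topologicalType) (f : X -> R[i]) :=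
  ccontinuous f /\ compact_support (fun x => normc (f x)).

Lemma continuous_normc (X : topologicalType) (f : X -> R[i]) :
  ccontinuous f -> continuous (fun x => normc (f x)).
Proof.
move=> [cr ci].
have -> : (fun x => normc (f x)) = @Num.sqrt R \o
    (fun x => complex.Re (f x) * complex.Re (f x) + complex.Im (f x) * complex.Im (f x)).
  by apply/funext => x /=; case: (f x) => a b /=; rewrite !expr2.
move=> x; apply: continuous_comp; last exact: sqrt_continuous.
by apply: continuousD; apply: continuousM; [exact: cr|exact: cr|exact: ci|exact: ci].
Qed.

Lemma ccontinuousB (X : topologicalType) (f g : X -> R[i]) :
  ccontinuous f -> ccontinuous g -> ccontinuous (fun x => f x - g x).
Proof.
move=> [fr fi] [gr gi]; split => x.
  under eq_fun do rewrite raddfB/=; apply: continuousB; [exact: fr|exact: gr].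
under eq_fun do rewrite raddfB/=; apply: continuousB; [exact: fi|exact: gi].
Qed.

Lemma ccontinuous_comp (X Y : topologicalType) (t : X -> Y) (f : Y -> R[i]) :
  continuous t -> ccontinuous f -> ccontinuous (f \o t).
Proof.
move=> ct [fr fi]; split => x.
  by apply: (@continuous_comp _ _ _ t (fun y => complex.Re (f y))); [exact: ct|exact: fr].
by apply: (@continuous_comp _ _ _ t (fun y => complex.Im (f y))); [exact: ct|exact: fi].
Qed.

Lemma ccontinuous_char (G : topologicalZmodType) (xi : character R G) :
  ccontinuous xi.
Proof.
split => x.
  apply: (@continuous_comp _ _ _ xi (fun z : R[i]^o => complex.Re z)).
    exact: char_continuous.
  exact: Re_continuous.
apply: (@continuous_comp _ _ _ xi (fun z : R[i]^o => complex.Im z)).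
  exact: char_continuous.
exact: Im_continuous.
Qed.

Lemma normc_char (G : topologicalZmodType) (xi : character R G) x :
  normc (xi x) = 1.
Proof. by have := char_norm1 xi x; rewrite normrE => -[]. Qed.

Lemma ccontinuous_borel (X : topologicalType) (x0 : X) (f : X -> R[i]) :
  ccontinuous f -> cmeasurable (f : borel x0 -> R[i]).
Proof. by move=> [fr fi]; split; exact: continuous_borel. Qed.

End complex_continuity.

Section stft.
Context (R : realType) (G : topologicalZmodType).
Variable mu : {measure set (borel (0 : G)) -> \bar R}.
Hypothesis hG : hausdorff_space G.
Hypothesis hmu : haar mu.
Implicit Types (f g : borel (0 : G) -> R[i]) (z : G * character R G).

Let muD (x : G) (A : set (borel (0 : G))) : measurable A ->
  mu [set (x + a)%R | a in (A : set G)] = mu A.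
Proof. by have [_ _ h] := hmu; exact: h. Qed.

(** Only upper bounds for the L^2 norm are needed; a real bound avoids roots and
    extended reals. *)
Definition L2_le f (A : R) :=
  cmeasurable f /\ (\int[mu]_x (normc (f x) ^+ 2)%:E <= (A ^+ 2)%:E)%E.

Lemma cmeasurable_translate f (x : G) : cmeasurable f ->
  cmeasurable (fun y : borel (0 : G) => f ((y : G) - x)).
Proof.
by move=> [fr fi]; split; [apply: (measurableT_comp fr)|apply: (measurableT_comp fi)];
  exact: translate_measurable.
Qed.

Lemma L2_le_translate f (A : R) (x : G) : L2_le f A ->
  L2_le (fun y : borel (0 : G) => f ((y : G) - x)) A.
Proof.
move=> [mf fA]; split; first exact: cmeasurable_translate.
apply: le_trans fA.
rewrite (@ge0_integral_translate R G mu muD (- x) (fun y => (normc (f y) ^+ 2)%:E))//.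
- apply/measurable_EFinP/measurable_funX; exact: cmeasurable_normc.
- by move=> y; rewrite lee_fin sqr_ge0.
Qed.

Definition stft_integrand f g z := fun y : borel (0 : G) =>
  f y * ((g ((y : G) - z.1))^*)%C * ((z.2 (y : G))^*)%C.

Lemma cmeasurable_stft_integrand f g z : cmeasurable f -> cmeasurable g ->
  cmeasurable (stft_integrand f g z).
Proof.
move=> mf mg; apply: cmeasurableM.
  apply: cmeasurableM => //; apply: cmeasurable_conj; exact: cmeasurable_translate.
by apply: cmeasurable_conj; apply: ccontinuous_borel; exact: ccontinuous_char.
Qed.

Lemma normc_stft_integrand f g z y :
  normc (stft_integrand f g z y) = `|normc (f y) * normc (g ((y : G) - z.1))|.
Proof.
by rewrite !normcM !normc_conj normc_char mulr1 ger0_norm// mulr_ge0 ?normc_ge0.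
Qed.

Lemma integral_stft_integrand f g z (A B : R) : 0 < A -> 0 < B -> L2_le f A -> L2_le g B ->
  (\int[mu]_y (normc (stft_integrand f g z y))%:E <= (A * B)%:E)%E.
Proof.
move=> A0 B0 [mf fA] /(L2_le_translate z.1) [mg gB].
under eq_integral do rewrite normc_stft_integrand.
apply: integral_mul_le => //; exact: cmeasurable_normc.
Qed.

Lemma stft_le f g z (A B : R) : 0 < A -> 0 < B -> L2_le f A -> L2_le g B ->
  normc (stft mu f g z) <= 2 * (A * B).
Proof.
move=> A0 B0 fA gB; apply: normc_cintegral.
  by apply: cmeasurable_stft_integrand; [exact: fA.1|exact: gB.1].
exact: integral_stft_integrand.
Qed.

Lemma cintegrable_stft_integrand f g z (A B : R) : 0 < A -> 0 < B ->
  L2_le f A -> L2_le g B -> cintegrable mu (stft_integrand f g z).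
Proof.
move=> A0 B0 fA gB; split.
  by apply: cmeasurable_stft_integrand; [exact: fA.1|exact: gB.1].
by apply: le_lt_trans (integral_stft_integrand z A0 B0 fA gB) _; exact: ltry.
Qed.

Lemma stftBl f f' g z (A A' B : R) : 0 < A -> 0 < A' -> 0 < B ->
  L2_le f A -> L2_le f' A' -> L2_le g B ->
  stft mu (fun y => f y - f' y) g z = stft mu f g z - stft mu f' g z.
Proof.
move=> A0 A'0 B0 fA f'A gB.
rewrite -(cintegralB (cintegrable_stft_integrand z A0 B0 fA gB)
  (cintegrable_stft_integrand z A'0 B0 f'A gB)).
by congr (cintegral mu _); apply/funext => y; rewrite /stft_integrand !mulrBl.
Qed.

Lemma stftBr f g g' z (A B B' : R) : 0 < A -> 0 < B -> 0 < B' ->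
  L2_le f A -> L2_le g B -> L2_le g' B' ->
  stft mu f (fun y => g y - g' y) z = stft mu f g z - stft mu f g' z.
Proof.
move=> A0 B0 B'0 fA gB g'B.
rewrite -(cintegralB (cintegrable_stft_integrand z A0 B0 fA gB)
  (cintegrable_stft_integrand z A0 B'0 fA g'B)).
congr (cintegral mu _); apply/funext => y.
by rewrite /stft_integrand rmorphB/= mulrBr mulrBl.
Qed.

Lemma L2_le_sub f f' (A : R) : 0 <= A -> L2_le f A -> cmeasurable f' ->
  L2_le (fun y => f y - f' y) A -> L2_le f' (2 * A).
Proof.
move=> A0 [mf fA] mf' [mff' ffA]; split => //.
have h : (\int[mu]_x (normc (f' x) ^+ 2)%:E <=
    \int[mu]_x ((normc (f x) + normc (f x - f' x)) ^+ 2)%:E)%E.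
  apply: le_ge0_integral => x; rewrite lee_fin ?sqr_ge0//.
  rewrite lerXn2r ?nnegrE ?addr_ge0 ?normc_ge0//.
  by have := normcD (f x) (f' x - f x); rewrite addrC subrK normcB.
apply: le_trans h _.
apply: le_trans (integral_sqrD_le mu (cmeasurable_normc mf) (cmeasurable_normc mff')) _.
apply: (@le_trans _ _ (2%:E * (A ^+ 2)%:E + 2%:E * (A ^+ 2)%:E)%E).
  by apply: leeD; apply: lee_wpmul2l.
by rewrite -!EFinM -EFinD lee_fin; lra.
Qed.

Hypothesis lG : locally_compact [set: G].

Lemma cCc_dense f (d : R) : cmeasurable f ->
  (\int[mu]_x (normc (f x) ^+ 2)%:E < +oo)%E -> 0 < d ->
  exists f' : G -> R[i], cCc f' /\ L2_le (fun y => f y - f' y) d.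
Proof.
move=> mf foo d0; have [rmu _ _] := hmu.
have e0 : 0 < d ^+ 2 / 2 by rewrite divr_gt0// exprn_gt0.
have [fr fi] := mf.
have [|h [ch sh fh]] := Cc_dense hG lG rmu fr _ e0.
  apply: le_lt_trans foo; apply: le_ge0_integral => x; rewrite lee_fin ?sqr_ge0//.
  by rewrite normc_sqr lerDl sqr_ge0.
have [|k [ck sk fk]] := Cc_dense hG lG rmu fi _ e0.
  apply: le_lt_trans foo; apply: le_ge0_integral => x; rewrite lee_fin ?sqr_ge0//.
  by rewrite normc_sqr lerDr sqr_ge0.
pose f' x := Complex (h x) (k x); exists f'.
have cf' : ccontinuous f' by split.
split; [split => //|split].
- apply: (compact_supportP hG (compactU sh sk)) => x hkx.
  have [hx kx] : h x = 0 /\ k x = 0.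
    by split; apply: compact_support0 => ?; apply: hkx; [left|right].
  by rewrite /f' hx kx /= expr0n/= addr0 sqrtr0.
- by apply: cmeasurableB => //; exact: ccontinuous_borel.
- under eq_integral do rewrite normc_sqr EFinD !raddfB/=.
  have mh := @continuous_borel R G 0 h ch.
  have mk := @continuous_borel R G 0 k ck.
  rewrite ge0_integralD//; last 4 first.
  + by move=> x _; rewrite lee_fin sqr_ge0.
  + by apply/measurable_EFinP/measurable_funX; exact: measurable_funB.
  + by move=> x _; rewrite lee_fin sqr_ge0.
  + by apply/measurable_EFinP/measurable_funX; exact: measurable_funB.
  by apply: le_trans (leeD fh fk) _; rewrite -EFinD lee_fin; lra.
Qed.

(** The transform is bilinear, and [stft_le] bounds the errors V (f - f', g) and
    V (f', g - g'). *)
Lemma stft_approx f g (A B e : R) : 0 < A -> 0 < B -> 0 < e ->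
  L2_le f A -> L2_le g B ->
  exists f' g' : G -> R[i], [/\ cCc f', cCc g', L2_le f' (2 * A), L2_le g' (2 * B) &
    forall z, normc (stft mu f g z - stft mu f' g' z) <= e].
Proof.
move=> A0 B0 e0 fA gB.
have oo h C : L2_le h C -> (\int[mu]_x (normc (h x) ^+ 2)%:E < +oo)%E.
  by move=> [_ hC]; apply: le_lt_trans hC (ltry _).
have mono h c C : 0 <= c -> c <= C -> L2_le h c -> L2_le h C.
  move=> c0 cC [mh hc]; split => //; apply: le_trans hc _.
  by rewrite lee_fin lerXn2r ?nnegrE// (le_trans c0).
(* With these d and d', each of the two error terms is at most e / 2. *)
pose d := Num.min A (e / (4 * B)); pose d' := Num.min B (e / (8 * A)).
have d0 : 0 < d by rewrite lt_min A0 divr_gt0// mulr_gt0.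
have d'0 : 0 < d' by rewrite lt_min B0 divr_gt0// mulr_gt0.
have [f' [cf' ff']] := cCc_dense fA.1 (oo _ _ fA) d0.
have [g' [cg' gg']] := cCc_dense gB.1 (oo _ _ gB) d'0.
have f'A : L2_le f' (2 * A).
  apply: (L2_le_sub (ltW A0) fA); first exact/ccontinuous_borel/cf'.1.
  by apply: mono ff'; [exact: ltW|rewrite ge_min lexx].
have g'B : L2_le g' (2 * B).
  apply: (L2_le_sub (ltW B0) gB); first exact/ccontinuous_borel/cg'.1.
  by apply: mono gg'; [exact: ltW|rewrite ge_min lexx].
have A20 : 0 < 2 * A by rewrite mulr_gt0.
have B20 : 0 < 2 * B by rewrite mulr_gt0.
exists f', g'; split => // z.
have -> : stft mu f g z - stft mu f' g' z =
    stft mu (fun y => f y - f' y) g z + stft mu f' (fun y => g y - g' y) z.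
  rewrite (stftBl z A0 A20 B0 fA f'A gB) (stftBr z A20 B0 B20 f'A gB g'B).
  by rewrite addrA subrK.
apply: le_trans (normcD _ _) _.
apply: le_trans (lerD (stft_le z d0 B0 ff' gB) (stft_le z A20 d'0 f'A gg')) _.
have h1 : d * (4 * B) <= e by rewrite -ler_pdivlMr ?mulr_gt0// ge_min lexx orbT.
have h2 : d' * (8 * A) <= e by rewrite -ler_pdivlMr ?mulr_gt0// ge_min lexx orbT.
lra.
Qed.

End stft.

(** * The short-time Fourier transform on C_c *)

Lemma normc_dist (R : realType) (z w : R[i]) :
  `|normc z - normc w| <= normc (z - w).
Proof.
rewrite ler_norml lerNl opprB !lerBlDr; apply/andP; split.
  by rewrite normcB; have := normcD (w - z) z; rewrite subrK.
by have := normcD (z - w) w; rewrite subrK.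
Qed.

Section stft_Cc.
Context (R : realType) (G : topologicalZmodType).
Variable mu : {measure set (borel (0 : G)) -> \bar R}.
Hypothesis hG : hausdorff_space G.
Hypothesis hmu : haar mu.

Let cpt_oo (K : set G) : compact K -> (mu K < +oo)%E.
Proof. by have [[h _ _] _ _] := hmu; exact: h. Qed.

Lemma compact_supportM (X : topologicalType) (u v : X -> R) :
  hausdorff_space X -> compact_support u -> compact_support (fun x => u x * v x).
Proof.
move=> hX su; apply: (compact_supportP hX su) => x /compact_support0 ->.
by rewrite mul0r.
Qed.

Lemma cCc_L2 (f : G -> R[i]) : cCc f -> exists2 A, 0 < A & L2_le mu f A.
Proof.
move=> [cf sf]; have cn := continuous_normc cf.
pose u x := normc (f x) * normc (f x).
have cu : continuous u by move=> x; apply: continuousM; exact: cn.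
have := integral_Cc_lty cpt_oo cu (compact_supportM hG sf).
have -> : (\int[mu]_x `|u x|%:E)%E = (\int[mu]_x (normc (f x) ^+ 2)%:E)%E.
  by apply: eq_integral => x _; rewrite /u ger0_norm -?expr2// sqr_ge0.
set I := integral _ _ _ => Ioo.
have I0 : (0 <= I)%E by apply: integral_ge0 => x _; rewrite lee_fin sqr_ge0.
have Ifin : I \is a fin_num by rewrite ge0_fin_numE.
have f0 := fine_ge0 I0.
exists (1 + fine I); first by rewrite ltr_pwDl.
split; first exact: ccontinuous_borel.
rewrite -/I -(fineK Ifin) lee_fin; nra.
Qed.

Variables f g : G -> R[i].
Hypotheses (sf : cCc f) (sg : cCc g).

Let subG_continuous (x : G) : continuous (fun y : G => y - x).
Proof. exact: translate_continuous. Qed.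

(** On the compact support K of f, the translates of g and the character depend
    uniformly on z: the former by compactness of K, the latter by definition of the
    compact-open topology. *)
Lemma stft_Cc_continuous : continuous (fun z => normc (stft mu f g z)).
Proof.
move=> -[x0 xi0].
have FF : Filter (nbhs ((x0, xi0) : G * character R G)) by exact: nbhs_filter.
apply/cvgrPdist_lt => e e0.
have [A A0 fA] := cCc_L2 sf; have [B B0 gB] := cCc_L2 sg.
have [Mf Mf0 fM] := compact_support_bounded (continuous_normc sf.1) sf.2.
have [Mg Mg0 gM] := compact_support_bounded (continuous_normc sg.1) sg.2.
pose K := closure [set x | normc (f x) != 0].
have cK : compact K by exact: sf.2.
have mK : measurable (K : set (borel (0 : G))).
  by apply: closed_borel; exact: closed_closure.
have Kfin : mu K \is a fin_num by rewrite ge0_fin_numE// cpt_oo.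
pose k := fine (mu K); have k0 : 0 <= k by exact: fine_ge0.
(* With this h, 2 * Mf * h * (1 + Mg) * mu K < e. *)
pose h := e / (4 * (Mf * (1 + Mg)) * (k + 1)).
have h0 : 0 < h by rewrite divr_gt0// !mulr_gt0// ltr_wpDl// ltW.
have near_g : nbhs x0 [set x | K `<=` [set y | normc (g (y - x) - g (y - x0)) < h]].
  apply: (iffLR (compact_near_coveringP K) cK) => y Ky.
  pose F (w : G * G) : R := normc (g (w.1 - w.2) - g (w.1 - x0)).
  have cF : continuous F.
    apply: continuous_normc; apply: ccontinuousB.
      apply: (@ccontinuous_comp _ _ _ (fun w : G * G => w.1 - w.2) g _ sg.1).
      exact: sub_continuous.
    apply: (@ccontinuous_comp _ _ _ (fun w : G * G => w.1 - x0) g _ sg.1) => w.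
    apply: (@continuous_comp _ _ _ (fst : G * G -> G) (fun y => y - x0)).
      exact: cvg_fst.
    exact: subG_continuous.
  apply: (cF (y, x0) [set r | r < h]).
  by apply: lt_nbhsl; rewrite /F /= subrr Normc.normc0.
have h0' : 0 < h%:C%C by rewrite ltcR.
exists ([set x | K `<=` [set y | normc (g (y - x) - g (y - x0)) < h]],
  [set xi : character R G | forall y, K y -> `|xi0 y - xi y| < h%:C%C]).
  by split; [exact: near_g|exact: char_nbhs].
move=> [x xi] [/= gx xix].
change (`|normc (stft mu f g (x0, xi0)) - normc (stft mu f g (x, xi))| < e).
apply: le_lt_trans (normc_dist _ _) _.
rewrite -(cintegralB (cintegrable_stft_integrand hmu _ A0 B0 fA gB)
  (cintegrable_stft_integrand hmu _ A0 B0 fA gB)).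
set c := Mf * (h * (1 + Mg)).
have c0 : 0 <= c.
  apply: mulr_ge0; first exact: ltW.
  by apply: mulr_ge0; [exact: ltW|apply: addr_ge0 => //; exact: ltW].
apply: (@le_lt_trans _ _ (2 * (c * k))).
  apply: normc_cintegral.
    by apply: cmeasurableB;
      (apply: cmeasurable_stft_integrand; [exact: fA.1|exact: gB.1]).
  apply: (@le_trans _ _ (\int[mu]_y (c%:E * (\1_K y)%:E))%E); last first.
    rewrite ge0_integralZl_EFin//; last first.
      by apply/measurable_EFinP; exact: measurable_indic.
    by rewrite integral_indic// setIT -(fineK Kfin).
  apply: le_ge0_integral => y; rewrite -?EFinM lee_fin ?normc_ge0//.
  rewrite /stft_integrand /= indicE.
  have [/set_mem Ky|/negP nKy] := boolP (y \in K); last first.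
    have fy : normc (f y) = 0.
      by apply: (@compact_support0 _ _ (fun x => normc (f x))) => Ky; apply: nKy; exact: mem_set.
    have {}fy := Normc.eq0_normc fy.
    by rewrite fy !mul0r subrr Normc.normc0 mulr0.
  rewrite mulr1 -!mulrA -mulrBr normcM.
  apply: ler_pM; rewrite ?normc_ge0//.
    by have := fM y; rewrite ger0_norm// normc_ge0.
  set a0 := (_^*)%C; set b0 := (_^*)%C; set a := (_^*)%C; set b := (_^*)%C.
  have -> : a0 * b0 - a * b = (a0 - a) * b + a0 * (b0 - b).
    by rewrite mulrBl mulrBr [RHS]addrC addrA subrK.
  apply: le_trans (normcD _ _) _; rewrite !normcM mulrDr mulr1.
  have ga : normc (a0 - a) <= h.
    rewrite /a0 /a -rmorphB/= normc_conj normcB ltW//; exact: gx.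
  have gb : normc (b0 - b) <= h.
    rewrite /b0 /b -rmorphB/= normc_conj ltW//.
    by have := xix y Ky; rewrite normrE ltcR.
  have b1 : normc b = 1 by rewrite normc_conj normc_char.
  have a0M : normc a0 <= Mg.
    by rewrite normc_conj; have := gM (y - x0); rewrite ger0_norm// normc_ge0.
  rewrite b1 mulr1; apply: lerD => //; rewrite mulrC.
  by apply: ler_pM; rewrite ?normc_ge0.
have -> : 2 * (c * k) = e * (k / (k + 1)) / 2.
  rewrite /c /h; field.
  by rewrite !gt_eqF//= ?ltr_wpDl// ltr_pwDl// ltW.
have k1 : 0 < k + 1 by rewrite ltr_wpDl.
have kk : k / (k + 1) <= 1 by rewrite ler_pdivrMr// mul1r lerDl.
have : e * (k / (k + 1)) <= e by rewrite ger_pMr.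
lra.
Qed.

End stft_Cc.

Section weak_type.
Context (R : realType) (G : topologicalZmodType).
Variable mu : {measure set (borel (0 : G)%R) -> \bar R}.
Variable nu : {measure set (borel (0 : character R G)) -> \bar R}.
Variable rho : {measure set (borel (0 : G, 0 : character R G)) -> \bar R}.
Hypothesis hG : hausdorff_space G.
Hypothesis lG : locally_compact [set: G].
Hypothesis hmu : haar mu.
Hypothesis hnu : haar nu.
Hypothesis mu_nu : plancherel mu nu.
Hypothesis hrho : radon_product mu nu rho.

Lemma sqr_cLnorm2 d (T : measurableType d)
    (m : {measure set T -> \bar R}) (h : T -> R[i]) :
  (cLnorm m 2%:E h `^ 2 = \int[m]_x (normc (h x) ^+ 2)%:E)%E.
Proof.
rewrite /cLnorm unlock -poweRrM mulVf// poweRe1.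
  apply: eq_integral => x _ /=; rewrite powR_mulrn//.
  by rewrite ger0_norm// normc_ge0.
by apply: integral_ge0 => x _; exact: poweR_ge0.
Qed.

Lemma stft_plancherel (f g : G -> R[i]) (x : G) : cCc f -> cCc g ->
  (\int[nu]_xi (normc (stft mu f g (x, xi)) ^+ 2)%:E =
   \int[mu]_y (normc (f y) ^+ 2 * normc (g (y - x)%R) ^+ 2)%:E)%E.
Proof.
move=> sf sg; have [[cpt_oo _ _] _ _] := hmu.
pose F y := f y * ((g (y - x))^*)%C.
have cn := continuous_normc sf.1.
have cg : continuous (fun y => normc (g (y - x))).
  move=> y; apply: (@continuous_comp _ _ _ (fun y : G => y - x) (fun y => normc (g y))).
    exact: translate_continuous.
  exact: continuous_normc sg.1 _.
have nF y : normc (F y) = normc (f y) * normc (g (y - x)).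
  by rewrite normcM normc_conj.
have mF : cmeasurable (F : borel (0 : G)%R -> R[i]).
  apply: cmeasurableM; first exact: ccontinuous_borel sf.1.
  apply: cmeasurable_conj; apply: (@cmeasurable_translate R G g x).
  exact: ccontinuous_borel sg.1.
have cF1 : continuous (fun y => normc (f y) * normc (g (y - x))).
  by move=> y; apply: continuousM; [exact: cn|exact: cg].
have sF1 : compact_support (fun y => normc (f y) * normc (g (y - x))).
  exact: compact_supportM sf.2.
have F1 : (cLnorm mu 1%:E (F : borel (0 : G)%R -> R[i]) < +oo)%E.
  rewrite /cLnorm Lnorm1; apply: le_lt_trans (integral_Cc_lty cpt_oo cF1 sF1).
  by apply: le_ge0_integral => y //; rewrite /= nF.
have F2 : (\int[mu]_y (normc (F y) ^+ 2)%:E < +oo)%E.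
  have cF2 : continuous (fun y => (normc (f y) * normc (g (y - x))) *
      (normc (f y) * normc (g (y - x)))).
    by move=> y; exact: (continuousM (cF1 y) (cF1 y)).
  apply: le_lt_trans (integral_Cc_lty cpt_oo cF2 (compact_supportM hG sF1)).
  apply: le_ge0_integral => y; rewrite lee_fin ?sqr_ge0//.
  by rewrite -nF -expr2 ler_norm.
have F2' : (cLnorm mu 2%:E (F : borel (0 : G)%R -> R[i]) < +oo)%E.
  by apply: (@lty_poweRy _ _ 2); rewrite ?sqr_cLnorm2.
have := mu_nu mF F1 F2' => /(congr1 (fun r => r `^ 2)%E).
rewrite !sqr_cLnorm2 => h; apply: (etrans h).
by apply: eq_integral => y _; rewrite nF exprMn.
Qed.

(** The measure of the open set {a < |V|} is approached by compact subsets K.  A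
    function phi in C_c (G x G^) with 1_K <= phi <= 1_{a < |V|} satisfies
    phi <= |V|^2 / a^2, and rho integrates phi iteratively; Plancherel evaluates the
    inner integral. *)
Lemma stft_Cc_weak (f g : G -> R[i]) (A B a : R) : 0 < a ->
  cCc f -> cCc g -> L2_le mu f A -> L2_le mu g B ->
  (rho [set z | (a < normc (stft mu f g z))%R] <= (A ^+ 2 * B ^+ 2 / a ^+ 2)%:E)%E.
Proof.
move=> a0 sf sg fA gB.
have [rrho prod] := hrho; have [_ _ inner] := rrho.
have a20 : 0 < a ^+ 2 by rewrite exprn_gt0.
have cV := stft_Cc_continuous hG hmu sf sg.
pose U : set (G * character R G) := [set z | a < normc (stft mu f g z)].
have oU : open U.
  apply: (iffLR (continuousP _) cV [set r | a < r]); exact: open_gt.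
have lX : locally_compact [set: character R G].
  exact: haar_locally_compact (@character_hausdorff R G) hnu.
have hX := @character_hausdorff R G.
rewrite [leLHS](inner U oU); apply: ge_ereal_sup => _ [K [cK KU] <-].
have [phi [cphi phi01 phiK phiU sphi]] :=
  urysohn_compact R (hausdorff_pair hG hX) (locally_compact_pair lG lX) cK oU KU.
have mK : measurable (K : set (borel (0 : G, 0 : character R G))).
  by apply: closed_borel; apply: compact_closed => //; exact: hausdorff_pair.
apply: (@le_trans _ _ (\int[rho]_z (phi z)%:E)%E).
  rewrite -[X in rho X]setIT -integral_indic//.
  apply: le_ge0_integral => z; rewrite lee_fin// indicE.
  by have [/set_mem/phiK ->//|_] := boolP (z \in K); have /andP[] := phi01 z.
rewrite prod//.
pose u y := normc (f y) ^+ 2 / a ^+ 2; pose v y := normc (g y) ^+ 2.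
have cX2 (h : G -> R[i]) : ccontinuous h -> continuous (fun y => normc (h y) ^+ 2).
  move=> /continuous_normc ch y; under eq_fun do rewrite expr2.
  exact: (continuousM (ch y) (ch y)).
have sX2 (h : G -> R[i]) : cCc h -> compact_support (fun y => normc (h y) ^+ 2).
  move=> [_ sh]; apply: (compact_supportP hG sh) => y.
  by move=> /(@compact_support0 _ _ (fun x => normc (h x))) ->; rewrite expr0n.
have cu : continuous u.
  by move=> y; apply: cvgMr_tmp; exact: (cX2 f sf.1).
have su : compact_support u.
  exact: compact_supportM hG (sX2 _ sf).
have u0 y : 0 <= u y by rewrite divr_ge0// ?sqr_ge0// ltW.
have v0 y : 0 <= v y by rewrite sqr_ge0.
apply: (@le_trans _ _ (\int[mu]_x \int[mu]_y (u y * v (y - x)%R)%:E)%E).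
  apply: le_ge0_integral => x.
    by apply: integral_ge0 => xi _; rewrite lee_fin; have /andP[] := phi01 (x, xi).
  have mV : measurable_fun [set: borel (0 : character R G)]
      (fun xi : borel (0 : character R G) =>
         normc (stft mu f g (x, xi : character R G)) ^+ 2).
    apply: measurable_funX; apply: continuous_borel => xi.
    apply: (@continuous_comp _ _ _ (fun xi : character R G => (x, xi))
      (fun z => normc (stft mu f g z))); last exact: cV.
    move=> W [[P Q] /= [Px Qxi] PQW]; apply: filterS Qxi => eta Qeta.
    by apply: PQW; split => //=; exact: nbhs_singleton.
  apply: (@le_trans _ _ (\int[nu]_xi
      ((a ^+ 2)^-1%:E * (normc (stft mu f g (x, xi)) ^+ 2)%:E))%E).
    apply: le_ge0_integral => xi; rewrite -?EFinM lee_fin;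
      have /andP[p0 p1] := phi01 (x, xi); first by [].
    have [Uxi|/phiU ->] := pselect (U (x, xi)); last first.
      by rewrite mulr_ge0 ?sqr_ge0// invr_ge0 ltW.
    apply: le_trans p1 _; rewrite mulrC ler_pdivlMr// mul1r.
    by rewrite lerXn2r ?nnegrE ?normc_ge0//; exact: ltW.
  rewrite ge0_integralZl_EFin//; last 3 first.
  - by move=> xi _; rewrite lee_fin sqr_ge0.
  - exact/measurable_EFinP.
  - by rewrite invr_ge0 ltW.
  rewrite stft_plancherel// -ge0_integralZl_EFin//; last 3 first.
  - by move=> y _; rewrite lee_fin mulr_ge0 ?sqr_ge0.
  - apply/measurable_EFinP; apply: measurable_funM; apply: continuous_borel.
      exact: cX2 sf.1.
    move=> y; apply: (@continuous_comp _ _ _ (fun y : G => y - x) v).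
      exact: translate_continuous.
    exact: (cX2 g sg.1).
  - by rewrite invr_ge0 ltW.
  apply: le_ge0_integral => y; rewrite -EFinM lee_fin.
    apply: mulr_ge0; first by rewrite invr_ge0 ltW.
    by rewrite mulr_ge0 ?sqr_ge0.
  by rewrite /u /v mulrCA mulrA mulrAC.
apply: le_trans (convolution_integral_le hG hmu cu (cX2 g sg.1) su (sX2 _ sg) u0 v0) _.
have -> : (\int[mu]_x (u x)%:E = (a ^+ 2)^-1%:E * \int[mu]_x (normc (f x) ^+ 2)%:E)%E.
  rewrite -ge0_integralZl_EFin//.
  - by apply: eq_integral => y _; rewrite -EFinM mulrC.
  - by move=> y _; rewrite lee_fin sqr_ge0.
  - by apply/measurable_EFinP; apply: continuous_borel; exact: cX2 sf.1.
  - by rewrite invr_ge0 ltW.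
apply: (@le_trans _ _ ((a ^+ 2)^-1%:E * (A ^+ 2)%:E * (B ^+ 2)%:E)%E).
  have a2i : (0 <= (a ^+ 2)^-1%:E)%E by rewrite lee_fin invr_ge0 ltW.
  apply: lee_pmul; last exact: gB.2.
  - by rewrite mule_ge0//; apply: integral_ge0 => y _; rewrite lee_fin sqr_ge0.
  - by apply: integral_ge0 => y _; rewrite lee_fin sqr_ge0.
  - by apply: lee_wpmul2l => //; exact: fA.2.
by rewrite -!EFinM lee_fin le_eqVlt; apply/orP; left; apply/eqP; ring.
Qed.

End weak_type.

(** * The estimate *)

Section stft_L2.
Context (R : realType) (G : topologicalZmodType).
Variable mu : {measure set (borel (0 : G)) -> \bar R}.
Variable nu : {measure set (borel (0 : character R G)) -> \bar R}.
Variable rho : {measure set (borel (0 : G, 0 : character R G)) -> \bar R}.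
Hypothesis hG : hausdorff_space G.
Hypothesis lG : locally_compact [set: G].
Hypothesis hmu : haar mu.
Hypothesis hnu : haar nu.
Hypothesis mu_nu : plancherel mu nu.
Hypothesis hrho : radon_product mu nu rho.
Variables (f g : borel (0 : G) -> R[i]) (A B : R).
Hypotheses (A0 : 0 < A) (B0 : 0 < B) (fA : L2_le mu f A) (gB : L2_le mu g B).

Lemma stft_continuous : continuous (fun z => normc (stft mu f g z)).
Proof.
move=> z0; have FF : Filter (nbhs z0) by exact: nbhs_filter.
apply/cvgrPdist_lt => e e0.
have e3 : 0 < e / 3 by rewrite divr_gt0.
have [f' [g' [sf sg _ _ V]]] := stft_approx hG hmu lG A0 B0 e3 fA gB.
have cV : continuous (fun z => normc (stft mu f' g' z)).
  exact: stft_Cc_continuous.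
have /cvgrPdist_lt /(_ _ e3) := cV z0; apply: filterS => z Vz.
have := normc_dist (stft mu f g z0) (stft mu f' g' z0).
have := normc_dist (stft mu f g z) (stft mu f' g' z).
have := V z; have := V z0; move: Vz.
set a := normc _; set b := normc _; set c := normc _; set d := normc _.
rewrite !ltr_norml !ler_norml => /andP[? ?] ? ? /andP[? ?] /andP[? ?].
by apply/andP; split; lra.
Qed.

Lemma stft_weak (a : R) : 0 < a ->
  (distribution_function rho (stft mu f g) a <= ((8 * (A * B)) ^+ 2 / a ^+ 2)%:E)%E.
Proof.
move=> a0; have a2 : 0 < a / 2 by rewrite divr_gt0.
have [f' [g' [sf sg fA' gB' V]]] := stft_approx hG hmu lG A0 B0 a2 fA gB.
have := stft_Cc_weak hG lG hmu hnu mu_nu hrho a2 sf sg fA' gB'.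
have -> : (2 * A) ^+ 2 * (2 * B) ^+ 2 / (a / 2) ^+ 2 = (8 * (A * B)) ^+ 2 / a ^+ 2.
  by field; rewrite gt_eqF.
apply: le_trans; apply: le_measure; rewrite ?inE.
- apply: open_borel.
  apply: (iffLR (continuousP _) stft_continuous [set r | a < r]).
  exact: open_gt.
- have cV := stft_Cc_continuous hG hmu sf sg.
  apply: open_borel; apply: (iffLR (continuousP _) cV [set r | a / 2 < r]).
  exact: open_gt.
- move=> z; rewrite /mkset => az.
  have := normc_dist (stft mu f g z) (stft mu f' g' z).
  have := V z; rewrite ler_norml => Vz /andP[_]; lra.
Qed.

Lemma lorentz_stft_le (q : R) : 2 < q ->
  (lorentz_norm rho q%:E 1%:E (stft mu f g) <=
   (8 * (q + (2^-1 - q^-1)^-1) * (A * B))%:E)%E.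
Proof.
move=> q2; have AB0 : 0 < A * B by exact: mulr_gt0.
have -> : 8 * (q + (2^-1 - q^-1)^-1) * (A * B) =
  (q + (2^-1 - q^-1)^-1) * (8 * (A * B)) by rewrite mulrAC mulrC.
apply: lorentz_norm1_le => //; first by rewrite mulr_gt0.
  by move=> z; apply: le_trans (stft_le hmu z A0 B0 fA gB) _; lra.
exact: stft_weak.
Qed.

End stft_L2.

Theorem theorem2p5 (R : realType) (G : topologicalZmodType)
    (G_hausdorff : hausdorff_space G)
    (G_locally_compact : locally_compact [set: G])
    (mu : {measure set (borel (0 : G)) -> \bar R})
    (nu : {measure set (borel (0 : character R G)) -> \bar R})
    (rho : {measure set (borel (0 : G, 0 : character R G)) -> \bar R})
    (mu_haar : haar mu) (nu_haar : haar nu) (mu_nu : plancherel mu nu)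
    (rho_product : radon_product mu nu rho)
    (q : R) (q_gt2 : 2 < q) :
  exists C : R, 0 < C /\
    forall f g : G -> R[i],
      lorentz_space mu 2%:E 1%:E f -> lorentz_space mu 2%:E 1%:E g ->
      (lorentz_norm rho q%:E 1%:E (stft mu f g) <=
        C%:E * lorentz_norm mu 2%:E 1%:E f * lorentz_norm mu 2%:E 1%:E g)%E.
Proof.
pose C := 8 * (q + (2^-1 - q^-1)^-1).
have q0 : 0 < q by exact: lt_trans q_gt2.
have C0 : 0 < C.
  by rewrite mulr_gt0// addr_gt0// invr_gt0 subr_gt0 ltf_pV2 ?posrE.
exists C; split => // f g [mf foo] [mg goo].
have L2 (h : borel (0 : G) -> R[i]) : cmeasurable h ->
    (lorentz_norm mu 2%:E 1%:E h < +oo)%E ->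
    exists N, [/\ 0 <= N, lorentz_norm mu 2%:E 1%:E h = N%:E &
      forall d, 0 < d -> L2_le mu h (N + d)].
  move=> mh hoo; have h0 : (0 <= lorentz_norm mu 2%:E 1%:E h)%E by exact: poweR_ge0.
  have hfin : lorentz_norm mu 2%:E 1%:E h \is a fin_num by rewrite ge0_fin_numE.
  have N0 := fine_ge0 h0.
  exists (fine (lorentz_norm mu 2%:E 1%:E h)); split; rewrite ?fineK// => d d0.
  split => //; apply: le_trans (integral_sqr_le_lorentz mh hoo) _.
  by rewrite lee_fin lerXn2r ?nnegrE// ?addr_ge0 ?lerDl//; exact: ltW.
have [M [M0 -> fM]] := L2 f mf foo; have [N [N0 -> gN]] := L2 g mg goo.
rewrite -!EFinM; apply/lee_addgt0Pr => e e0.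
(* d is small enough that C (M + d) (N + d) <= C M N + e *)
pose d := Num.min 1 (e / (C * (M + N + 1))).
have MN1 : 0 < C * (M + N + 1) by rewrite mulr_gt0// ltr_wpDl// addr_ge0.
have d0 : 0 < d by rewrite lt_min ltr01 divr_gt0.
have d1 : d <= 1 by rewrite ge_min lexx.
have de : d * (C * (M + N + 1)) <= e by rewrite -ler_pdivlMr// ge_min lexx orbT.
have Md : 0 < M + d by rewrite ltr_wpDl.
have Nd : 0 < N + d by rewrite ltr_wpDl.
apply: le_trans (lorentz_stft_le G_hausdorff G_locally_compact mu_haar nu_haar
  mu_nu rho_product Md Nd (fM d d0) (gN d d0) q_gt2) _.
rewrite -EFinD lee_fin -/C.
apply: (@le_trans _ _ (C * M * N + d * (C * (M + N + 1)))); last by rewrite lerD2l.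
have : C * d * d <= C * d by rewrite ger_pMr// mulr_gt0.
lra.
Qed.
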